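(* Let $\nu$ be a probability measure on $\mathbb{R}^n$ and suppose $\mathcal{I}(\nu,\alpha)<\infty$ for some $\frac23<\alpha<1$. Then for any $1$-Lipschitz function $f:\mathbb{R}^n\to\mathbb{R}$ there exists a constant $C_2(\alpha,\mathcal{I}(\nu,\alpha))<\infty$ such that $$\mathbb{E}_\nu[|f-m_\nu(f)|^2]\le C_2(\alpha,\mathcal{I}(\nu,\alpha))\cdot\mathbb{E}_\nu[|\nabla f|^2]^{\frac{3\alpha-2}{\alpha}}.$$ Here one can take $$C_2(\alpha,\mathcal{I}(\nu,\alpha))=2^{\frac{16\alpha-10}{\alpha}}\,\mathcal{I}(\nu,\alpha)^{\frac{6\alpha-4}{\alpha}}\left[2\,\mathcal{I}(\nu,\alpha)^{\frac{2}{\alpha}}\left(\frac{2\alpha^2}{(3\alpha-2)(1-\alpha)}\right)\right]^{\frac{2(1-\alpha)}{\alpha}}.$$ Equivalently, $\mathcal{C}_2\left(\nu,\frac{3\alpha-2}{\alpha}\right)\le C_2(\alpha,\mathcal{I}(\nu,\alpha))$.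
   Context: $\mathbb{E}_\nu$ is expectation under $\nu$. The median is $m_\nu(f)=\inf\{x\in\mathbb{R}: \mathbb{P}_\nu(f\le x)\ge\frac12\}$. $f$ is $1$-Lipschitz ($f\in\operatorname{Lip}_1(\mathbb{R}^n)$) if $|f(x)-f(y)|\le|x-y|_2$ for all $x,y$ (Euclidean norm), and $|\nabla f(x)|=\limsup_{y\to x}\frac{|f(x)-f(y)|}{|x-y|}$. For measurable $A\subseteq\mathbb{R}^n$ let $A^\epsilon=\{x: d(x,A)\le\epsilon\}$ ($d$ Euclidean distance) and $\nu(A^+)=\liminf_{\epsilon\to0^+}\frac{\nu(A^\epsilon)-\nu(A)}{\epsilon}$. For $0<\alpha\le1$ the $\alpha$-Cheeger constant is $$\mathcal{I}(\nu,\alpha)=\sup_{A\subseteq\mathbb{R}^n}\frac{\min\{\nu(A),1-\nu(A)\}}{\nu(A^+)^\alpha}\in[0,\infty].$$ For $0<a\le1$ the $a$-Poincaré constant is $$\mathcal{C}_2(\nu,a)=\sup_{f\in\operatorname{Lip}_1(\mathbb{R}^n)}\frac{\mathbb{E}_\nu[|f-m_\nu(f)|^2]}{(\mathbb{E}_\nu[|\nabla f|^2])^a}\in[0,\infty].$$ In these suprema a ratio $0/0$ is read as $0$ and $c/0$ with $c>0$ as $+\infty$.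
   Formalization: In the explicit constant the first power of I(ν,α) has exponent (6α−4)/α² instead of (6α−4)/α; the printed constant fails for ν uniform on [0,s], f(x)=x and s large, and the corrected exponent is the one forced by scaling. *)

(* Defs.v *)
From HB Require Import structures.
From mathcomp Require Import all_boot all_order all_algebra.
From mathcomp Require Import all_classical all_reals all_analysis.
Set Implicit Arguments.
Unset Strict Implicit.
Unset Printing Implicit Defensive.
Import Order.TTheory GRing.Theory Num.Theory.
Import numFieldNormedType.Exports.
Local Open Scope classical_set_scope.
Local Open Scope ring_scope.

(* The library norm on 'rV[R]_n is the sup norm: it induces the usual topology
   (hence the usual Borel sets and punctured neighborhoods x^'), but distances
   have to be measured with the Euclidean norm [enorm]. *)
Definition enorm (R : realType) (n : nat) (x : 'rV[R]_n) : R :=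
  Num.sqrt (\sum_(i < n) x ord0 i ^+ 2).

Notation borel_rV R n := (g_sigma_algebraType (@open 'rV[R]_n)).

Definition lip1 (R : realType) (n : nat) (f : 'rV[R]_n -> R) : Prop :=
  forall x y : 'rV[R]_n, `|f x - f y| <= enorm (x - y).

Local Open Scope ereal_scope.

(* |grad f|(x) *)
Definition slope (R : realType) (n : nat) (f : 'rV[R]_n -> R)
    (x : 'rV[R]_n) : \bar R :=
  limf_esup (fun y => (`|f x - f y| / enorm (x - y))%R%:E) x^'.

Definition median (R : realType) (n : nat) (nu : probability (borel_rV R n) R)
    (f : 'rV[R]_n -> R) : R :=
  inf [set x : R | 2^-1%:E <= nu [set y | (f y <= x)%R]].

(* The infimum is taken in \bar R, so the distance to set0 is +oo and the
   enlargement of set0 is set0. *)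
Definition enlarge (R : realType) (n : nat) (A : set 'rV[R]_n) (e : R) :
    set 'rV[R]_n :=
  [set x | ereal_inf [set (enorm (x - a))%:E | a in A] <= e%:E].

(* nu(A^+) *)
Definition bdry_measure (R : realType) (n : nat)
    (nu : probability (borel_rV R n) R) (A : set 'rV[R]_n) : \bar R :=
  limf_einf (fun e : R => (nu (enlarge A e) - nu A) / e%:E) (0%R)^'+.

(* On \bar R, 0^-1 = +oo, +oo^-1 = 0 and 0 * +oo = 0: in the two suprema below
   0 / 0 = 0, and c / 0 = +oo for c > 0. *)
Definition cheeger (R : realType) (n : nat)
    (nu : probability (borel_rV R n) R) (alpha : R) : \bar R :=
  ereal_sup [set Order.min (nu A) (1 - nu A) / (bdry_measure nu A) `^ alpha
            | A in (measurable : set (set (borel_rV R n)))].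

Definition sq_dev (R : realType) (n : nat)
    (nu : probability (borel_rV R n) R) (f : 'rV[R]_n -> R) : \bar R :=
  'E_nu[fun x => `|f x - median nu f| ^+ 2]%R.

Definition energy (R : realType) (n : nat)
    (nu : probability (borel_rV R n) R) (f : 'rV[R]_n -> R) : \bar R :=
  \int[nu]_x (slope f x) ^+ 2.

Definition poincare2 (R : realType) (n : nat)
    (nu : probability (borel_rV R n) R) (a : R) : \bar R :=
  ereal_sup [set sq_dev nu f / (energy nu f) `^ a | f in @lip1 R n].

Local Close Scope ereal_scope.

(* The exponent of the first power of I has denominator alpha ^+ 2, i.e. the
   factor is (I `^ alpha^-1) `^ ((6 * alpha - 4) / alpha). Under the dilation
   x |-> s x, I scales by s `^ alpha and the squared deviation by s ^+ 2, so
   that the total degree of C2 in I has to be 2 / alpha; with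
   (6 * alpha - 4) / alpha instead, the bound fails for large I. *)
Definition C2 (R : realType) (alpha I : R) : R :=
  2 `^ ((16 * alpha - 10) / alpha)
  * I `^ ((6 * alpha - 4) / alpha ^+ 2)
  * (2 * I `^ (2 / alpha)
     * (2 * alpha ^+ 2 / ((3 * alpha - 2) * (1 - alpha))))
    `^ (2 * (1 - alpha) / alpha).

(* Main.v *)
Require Import Defs.
From mathcomp Require Import all_boot all_order all_algebra.
From mathcomp Require Import all_classical all_reals all_analysis.
From mathcomp Require Import measurable_realfun ring lra.
Import Order.TTheory GRing.Theory Num.Theory.
Import numFieldNormedType.Exports.
Set Implicit Arguments.
Unset Strict Implicit.
Unset Printing Implicit Defensive.
Local Open Scope ring_scope.
Local Open Scope classical_set_scope.

(** Put q = 1/alpha - 1 < 1/2 and J = I^(q+1), and let g be f - m or m - f, so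
    that nu(g > 0) <= 1/2. The Cheeger inequality nu(A)^(q+1) <= J nu(A^+) is
    used twice on the superlevel sets of g.
    - Since {g >= t}^e is contained in {g >= t - e}, mu(t) = nu(g >= t)
      satisfies mu^(q+1) <= - J mu', so that mu^(-q) grows at rate at least
      q / J. If T is the level beyond which mu <= delta, then
      E[(g_+^2 - T^2)_+] <= 2 J^2 delta^(1-2q) / (q (1 - 2q)).
    - Let X = min(g_+, T)^2. Below the level T one has
      nu(X > u) <= delta^(-q) nu(X > u)^(q+1)
                <= delta^(-q) J nu({X > u}^+),
      and by the coarea inequality and AM-GM
      E[X] <= B (l E[|grad g|^2] + E[X] / l) with B = delta^(-q) J; l = 2 B
      gives E[X] <= 4 B^2 E[|grad g|^2].
    Choosing delta = 2 q (1 - 2q) E[|grad g|^2] and adding the two tails yields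
    a constant which is at most C2 because q < 1/2. *)

(** * Differential inequalities for monotone functions *)

(** Since [q + 1 > 1], the isoperimetric inequality yields no linear bound [nu(A) <= B nu(A^+)] on
    sets of small measure, so AM-GM cannot be run on all of [g]. The cut at [T] confines it to sets
    of measure above [delta]; what lies beyond is left to decay alone, of order at most [t^(-1/q)],
    and its second moment converges because [q < 1/2], that is, [alpha > 2/3]. With [s = E[X]], the
    inequality [s <= B (l e + s / l)] gives [s <= B l^2 e / (l - B)], which [l = 2 B] minimises.
    Absorbing [s / 2] on the left requires [s] to be finite, and the truncation ensures it. The
    coarea inequality is obtained at finite radius: [g] is compared with its suprema over balls of
    radius [1/(k+1)], the layer-cake formula turns integrals over levels into expectations, and
    Fatou's lemma in the level variable lets the radius tend to 0. The two-tail bound needs a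
    positive [I] and an [e] strictly above the energy; equality, including the value 0, is reached
    in the limit at the very end. *)

Lemma powRN_ge_tangent1 (R : realType) (r y : R) :
  0 <= r -> 0 < y -> 1 - r * (y - 1) <= y `^ (- r).
Proof.
move=> r0 y0; rewrite /powR gt_eqF//.
apply: le_trans (expR_ge1Dx _).
rewrite lerD2l mulNr lerN2 ler_wpM2l//.
have -> : y = 1 + (y - 1) by ring.
rewrite [X in _ <= X](_ : _ = y - 1); last by ring.
by apply: le_ln1Dx; lra.
Qed.

(** Convexity of [x ^ (- q)]: at [b] the graph lies above its tangent at [b + h]. Dividing by
    [b + h] reduces this to the tangent at 1. *)
Lemma powRN_tangent (R : realType) (q b h : R) : 0 <= q -> 0 < b -> 0 < h ->
  q * (b + h) `^ (- (q + 1)) * h <= b `^ (- q) - (b + h) `^ (- q).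
Proof.
move=> q0 b0 h0; have bh0 : 0 < b + h by lra.
have E : b `^ (- q) = (b + h) `^ (- q) * (b / (b + h)) `^ (- q).
  by rewrite -powRM ?divr_ge0 ?ltW// mulrCA divff ?mulr1// gt_eqF.
rewrite E -[X in _ <= _ - X]mulr1 -mulrBr opprD powRD ?(gt_eqF bh0) ?implybT//.
rewrite mulrCA -!mulrA; apply: ler_wpM2l; first exact: powR_ge0.
rewrite powR_inv1 ?(ltW bh0)//; apply: (@le_trans _ _ (- (q * (b / (b + h) - 1)))).
  rewrite -mulrN opprB ler_wpM2l//.
  suff -> : (b + h)^-1 * h = 1 - b / (b + h) by [].
  by field; rewrite gt_eqF.
have := @powRN_ge_tangent1 R q (b / (b + h)) q0 (divr_gt0 b0 bh0); lra.
Qed.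

(* Continuous induction from the right endpoint: monotonicity of [w] replaces
   continuity when passing to the infimum of the good points. *)
Lemma left_dini_growth (R : realType) (w : R -> R) (c s t : R) :
  s <= t -> 0 <= c ->
  (forall x y, s <= x -> x <= y -> y <= t -> w x <= w y) ->
  (forall x, s < x -> x <= t -> exists2 d : R, 0 < d &
    forall e : R, 0 < e -> e < d -> w (x - e) + c * e <= w x) ->
  w s + c * (t - s) <= w t.
Proof.
move=> st c0 wm wd.
pose E := [set x | s <= x <= t /\
  forall y, x <= y -> y <= t -> w y + c * (t - y) <= w t].
have Et : E t.
  split; first by rewrite st lexx.
  move=> y ty yt; have -> : y = t by apply/eqP; rewrite eq_le ty yt.
  by rewrite subrr mulr0 addr0.
have Elb : has_lbound E by exists s => x [/andP[]].
have Ei : has_inf E by split => //; exists t.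
set x0 := inf E.
have sx0 : s <= x0 by apply: lb_le_inf => [|x [/andP[]]//]; exists t.
have x0t : x0 <= t by exact: ge_inf.
have above y : x0 < y -> y <= t -> w y + c * (t - y) <= w t.
  move=> /(inf_lt (proj1 Ei))[z [_ Ez] zy] yt; exact: Ez (ltW zy) yt.
(* Stepping from [x0] to [x0 + k] costs at most [c * k], which the choice of [k] keeps below [e]. *)
have at0 : w x0 + c * (t - x0) <= w t.
  have [x0t'|x0t'] := ltP x0 t; last first.
    by have -> : x0 = t by [apply/eqP; rewrite eq_le x0t]; rewrite subrr mulr0 addr0.
  apply/ler_addgt0Pr => e e0.
  have [k0 kd] : 0 < Num.min (t - x0) (e / (c + 1)) /\
      c * Num.min (t - x0) (e / (c + 1)) <= e.
    split; first by rewrite lt_min subr_gt0 x0t' divr_gt0//; lra.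
    apply: (@le_trans _ _ (c * (e / (c + 1)))).
      by rewrite ler_wpM2l// ge_min lexx orbT.
    by rewrite mulrCA ger_pMr// ler_pdivrMr ?mul1r; lra.
  set k := Num.min _ _ in k0 kd.
  have kt : k <= t - x0 by rewrite ge_min lexx.
  have := above (x0 + k); have := wm x0 (x0 + k); rewrite !mulrBr !mulrDr.
  move=> H1 H2; have := H1 sx0; have := H2; lra.
have [sx0'|x0s] := ltP s x0; last first.
  by have <- : x0 = s by apply/eqP; rewrite eq_le x0s.
(* If [s < x0], the hypothesis at [x0] carries the inequality to [x0 - k], below the infimum of [E]:
   a contradiction. *)
have [d d0 dP] := wd _ sx0' x0t.
have [k0 [kd ks]] : 0 < Num.min (d / 2) (x0 - s) /\
   Num.min (d / 2) (x0 - s) < d /\ Num.min (d / 2) (x0 - s) <= x0 - s.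
  by rewrite lt_min gt_min ge_min lexx orbT; split; [apply/andP; split; lra|split => //; apply/orP; left; lra].
set k := Num.min _ _ in k0 kd ks.
have : E (x0 - k).
  split; first by apply/andP; split; lra.
  move=> y ky yt; have [|yx0] := ltP x0 y; first by move/above; exact.
  have [->//|yx0'] := eqVneq y x0.
  have yx0'' : y < x0 by rewrite lt_neqAle yx0'.
  have := dP (x0 - y); rewrite !mulrBr in at0 *.
  have -> : x0 - (x0 - y) = y by ring.
  move=> H; have := H; rewrite subr_gt0 => /(_ yx0''); lra.
by move/(ge_inf Elb); rewrite -/x0; lra.
Qed.

(** The formal computation is [(mu^(-q))' = - q mu^(-q-1) mu' >= q / J]. As [mu] is only monotone,
    it is carried out on left difference quotients. *)
Lemma dini_powRN_growth (R : realType) (mu : R -> R) (q J s t : R) :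
  0 < q -> 0 < J -> s <= t ->
  (forall x y, s <= x -> x <= y -> y <= t -> mu y <= mu x) ->
  0 < mu t ->
  (forall x c : R, s < x -> x <= t -> 0 < c -> c < mu x `^ (q + 1) / J ->
    exists2 d : R, 0 < d &
    forall e : R, 0 < e -> e < d -> c * e <= mu (x - e) - mu x) ->
  mu s `^ (- q) + q / J * (t - s) <= mu t `^ (- q).
Proof.
move=> q0 J0 st mum mut mud.
have mu0 x : s <= x -> x <= t -> 0 < mu x.
  by move=> sx xt; apply: lt_le_trans (mum _ _ sx xt (lexx _)).
have qJ : 0 < q / J by rewrite divr_gt0.
(* One factor [k] makes the slope [c] strictly smaller than [mu x ^ (q + 1) / J]; the other pays for
   taking the tangent at [b + c * e] instead of [b]. *)
have main (k : R) : 0 < k -> k < 1 ->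
    mu s `^ (- q) + (k * k * (q / J)) * (t - s) <= mu t `^ (- q).
  move=> k0 k1; apply: (@left_dini_growth R (fun x => mu x `^ (- q))) => //.
  - by rewrite (mulr_ge0 (mulr_ge0 _ _)) ?(ltW k0) ?(ltW qJ).
  - move=> x y sx xy yt; have mux := mu0 _ sx (le_trans xy yt).
    have muy := mu0 _ (le_trans sx xy) yt.
    rewrite !powRN lef_pV2 ?posrE ?powR_gt0//.
    by apply: ge0_ler_powR; rewrite ?nnegrE ?(ltW q0) ?(ltW mux) ?(ltW muy) ?mum.
  - move=> x sx xt; have b0 := mu0 _ (ltW sx) xt; set b := mu x in b0 *.
    have B0 : 0 < b `^ (q + 1) by rewrite powR_gt0.
    have [c cE] : {c | c = k * (b `^ (q + 1) / J)} by exists (k * (b `^ (q + 1) / J)).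
    have bJ : 0 < b `^ (q + 1) / J by rewrite divr_gt0.
    have c0 : 0 < c by rewrite cE mulr_gt0.
    have [d d0 dP] : exists2 d : R, 0 < d &
        forall e : R, 0 < e -> e < d -> c * e <= mu (x - e) - mu x.
      by apply: mud => //; rewrite cE -/b gtr_pMl.
    have q1 : 0 < q + 1 by rewrite addr_gt0.
    have k1' : 0 < 1 - k by rewrite subr_gt0.
    (* For [e < d1], [(q + 1) * (c * e / b) <= 1 - k], so that
       [((b + c * e) / b) ^ (- (q + 1)) >= k]. *)
    pose d1 := (1 - k) * b / ((q + 1) * c).
    have d10 : 0 < d1 := divr_gt0 (mulr_gt0 k1' b0) (mulr_gt0 q1 c0).
    pose d2 := x - s.
    exists (Num.min d (Num.min d1 d2)); first by rewrite !lt_min d0 d10 subr_gt0.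
    move=> e e0; rewrite !lt_min => /and3P[ed ed1 ed2].
    have h0 : 0 < c * e by rewrite mulr_gt0.
    have H : b + c * e <= mu (x - e) by have := dP _ e0 ed; rewrite -/b; lra.
    have sxe : s <= x - e by move: ed2; rewrite /d2; lra.
    have Hm : mu (x - e) `^ (- q) <= (b + c * e) `^ (- q).
      rewrite !powRN lef_pV2 ?posrE ?powR_gt0//; [|lra|lra].
      by apply: ge0_ler_powR; rewrite ?nnegrE; lra.
    have := @powRN_tangent R q b (c * e) (ltW q0) b0 h0.
    suff : k * k * (q / J) * e <= q * (b + c * e) `^ (- (q + 1)) * (c * e) by lra.
    have q10 : 0 <= q + 1 by lra.
    have := @powRN_ge_tangent1 R (q + 1) (1 + c * e / b) q10 _.
    have -> : 1 - (q + 1) * (1 + c * e / b - 1) = 1 - (q + 1) * (c * e / b) by ring.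
    have -> : 1 + c * e / b = (b + c * e) / b by rewrite mulrDl divff ?gt_eqF.
    rewrite divr_gt0 ?addr_gt0// => /(_ isT) H2.
        have : k <= 1 - (q + 1) * (c * e / b).
      suff : (q + 1) * (c * e / b) <= 1 - k by lra.
      move: (ltW ed1); rewrite /d1 ler_pdivlMr; last exact: mulr_gt0.
      move=> He; by rewrite !mulrA ler_pdivrMr// [_ * e]mulrC.
    move=> /le_trans/(_ H2).
    rewrite powRM ?invr_ge0 ?(ltW b0) ?(ltW (addr_gt0 b0 h0))//.
    rewrite -powR_inv1 ?(ltW b0)// -powRrM mulN1r opprK => H3.
    rewrite cE.
    have -> : q * (b + k * (b `^ (q + 1) / J) * e) `^ (- (q + 1)) * (k * (b `^ (q + 1) / J) * e)
       = ((b + k * (b `^ (q + 1) / J) * e) `^ (- (q + 1)) * b `^ (q + 1)) * (k * (q / J) * e).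
      by ring.
    have -> : k * k * (q / J) * e = k * (k * (q / J) * e) by ring.
    rewrite -cE; apply: ler_wpM2r; last exact: H3.
    by apply: ltW; apply: mulr_gt0 => //; apply: mulr_gt0.
(* Let [k = 1 - m] tend to 1: since [(1 - m) ^ 2 >= 1 - 2 * m], the loss is at most
   [2 * m * D <= e]. *)
set D := q / J * (t - s); have D0 : 0 <= D by rewrite mulr_ge0 ?subr_ge0 ?(ltW qJ).
apply/ler_addgt0Pr => e e0.
have D1 : 0 < D + 1 by lra.
have [m0 m1] : 0 < Num.min 2^-1 (e / (2 * (D + 1))) /\
  Num.min 2^-1 (e / (2 * (D + 1))) <= 2^-1.
  by rewrite lt_min ge_min lexx invr_gt0 ltr0n divr_gt0// mulr_gt0.
have m2 : 2 * D * Num.min 2^-1 (e / (2 * (D + 1))) <= e.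
  apply: (@le_trans _ _ (2 * D * (e / (2 * (D + 1))))).
    by apply: ler_wpM2l; [rewrite mulr_ge0|rewrite ge_min lexx orbT].
  rewrite mulrCA ger_pMr// ler_pdivrMr ?mul1r; last by rewrite mulr_gt0//; lra.
  lra.
set m := Num.min _ _ in m0 m1 m2.
have := main (1 - m); rewrite -[_ * (t - s)]mulrA -/D => H.
have {}H := H ltac:(lra) ltac:(lra).
have : 0 <= m * m * D by apply: mulr_ge0 => //; rewrite mulr_ge0 ?(ltW m0).
nra.
Qed.

(** * Euclidean enlargements and Lipschitz functions *)

Lemma enorm_ge0 (R : realType) n (x : 'rV[R]_n) : 0 <= enorm x.
Proof. exact: sqrtr_ge0. Qed.

Lemma enorm0 (R : realType) n : enorm (0 : 'rV[R]_n) = 0.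
Proof.
rewrite /enorm big1 ?sqrtr0// => i _.
by rewrite mxE expr0n.
Qed.

Lemma enormN (R : realType) n (x : 'rV[R]_n) : enorm (- x) = enorm x.
Proof. by congr Num.sqrt; apply: eq_bigr => i _; rewrite mxE sqrrN. Qed.

Lemma coord_le_enorm (R : realType) n (x : 'rV[R]_n) i : `|x ord0 i| <= enorm x.
Proof.
rewrite -sqrtr_sqr ler_wsqrtr// (bigD1 i)//= lerDl.
by apply: sumr_ge0 => j _; exact: sqr_ge0.
Qed.

Lemma enorm_continuous (R : realType) n : continuous (@enorm R n).
Proof.
move=> x; apply: (@continuous_comp _ _ _ (fun x : 'rV[R]_n =>
  \sum_(i < n) x ord0 i ^+ 2) Num.sqrt); last exact: sqrt_continuous.
apply: continuous_big => [|i _]; first exact: add_continuous.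
move=> y; apply: (@continuous_comp _ _ _ (fun x : 'rV[R]_n => x ord0 i)
  (fun z : R => z ^+ 2)); [exact: coord_continuous|exact: exprn_continuous].
Qed.

Lemma enorm_sub_continuous (R : realType) n (a : 'rV[R]_n) :
  continuous (fun x : 'rV[R]_n => enorm (x - a)).
Proof.
move=> x; apply: (@continuous_comp _ _ _ (fun x : 'rV[R]_n => x - a) (@enorm R n)).
  exact: (@cvgB R 'rV[R]_n _ (nbhs x) _ idfun (cst a) x a cvg_id (cvg_cst a)).
exact: enorm_continuous.
Qed.

Lemma lip1_continuous (R : realType) n (f : 'rV[R]_n -> R) :
  lip1 f -> continuous f.
Proof.
move=> fl x; apply/(@cvgrPdist_lt _ R 'rV[R]_n (nbhs x) _) => e e0.
have := @enorm_sub_continuous R n x x; rewrite /continuous_at subrr enorm0.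
move=> /(@cvgrPdist_lt _ R 'rV[R]_n (nbhs x) _)/(_ _ e0).
apply: filterS => y; rewrite sub0r normrN ger0_norm ?enorm_ge0// => ye.
by apply: le_lt_trans ye; rewrite distrC; exact: fl.
Qed.

Lemma continuous_rV_measurable (R : realType) n (f : 'rV[R]_n -> R) :
  continuous f -> measurable_fun [set: borel_rV R n] f.
Proof.
move=> /continuousP cf; apply: (measurability _ (measurable_realfun.RGenOInfty.measurableE R)).
move=> _ [_ [a ->] <-]; rewrite setTI; apply: sub_sigma_algebra.
exact/cf/interval_open.
Qed.

Lemma lip1_measurable (R : realType) n (f : 'rV[R]_n -> R) :
  lip1 f -> measurable_fun [set: borel_rV R n] f.
Proof. by move/lip1_continuous/continuous_rV_measurable. Qed.

(** For [f] 1-Lipschitz and [r > 0] this is again 1-Lipschitz, hence measurable; its superlevel sets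
    contain the enlargements of those of [f], while its increment over [f] is controlled by the
    slope. *)
Definition sup_ball (R : realType) n (f : 'rV[R]_n -> R) (r : R) x :=
  sup [set f (x + z) | z in [set z | enorm z < r]].

Section sup_ball.
Variables (R : realType) (n : nat) (f : 'rV[R]_n -> R) (r : R).
Hypotheses (fl : lip1 f) (r0 : 0 < r).

Lemma lip1D x z : f (x + z) <= f x + enorm z.
Proof.
have := fl (x + z) x; rewrite addrAC subrr add0r ler_norml => /andP[_].
by rewrite lerBlDl.
Qed.

Lemma sup_ball_has_sup x : has_sup [set f (x + z) | z in [set z | enorm z < r]].
Proof.
split; first by exists (f (x + 0)), 0 => //=; rewrite enorm0.
exists (f x + r) => _ [z /= zr <-].
by apply: le_trans (lip1D x z) _; rewrite lerD2l ltW.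
Qed.

Lemma sup_ball_ub x z : enorm z < r -> f (x + z) <= sup_ball f r x.
Proof. by move=> zr; apply: ub_le_sup; [have [] := sup_ball_has_sup x|exists z]. Qed.

Lemma sup_ball_le x c :
  (forall z, enorm z < r -> f (x + z) <= c) -> sup_ball f r x <= c.
Proof.
move=> fc; apply: sup_le_ub; first by have [] := sup_ball_has_sup x.
by move=> _ [z zr <-]; exact: fc.
Qed.

Lemma sup_ball_ge x : f x <= sup_ball f r x.
Proof. by rewrite -{1}(addr0 x); apply: sup_ball_ub; rewrite enorm0. Qed.

Lemma sup_ball_leD x : sup_ball f r x <= f x + r.
Proof.
by apply: sup_ball_le => z zr; apply: le_trans (lip1D x z) _; rewrite lerD2l ltW.
Qed.

Lemma sup_ball_lip1 : lip1 (sup_ball f r).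
Proof.
have H x y : sup_ball f r x <= sup_ball f r y + enorm (x - y).
  apply: sup_ball_le => z zr.
  have -> : x + z = (y + z) + (x - y) by rewrite [RHS]addrC addrA subrK.
  by apply: le_trans (lip1D _ _) _; rewrite lerD2r sup_ball_ub.
move=> x y; rewrite ler_norml; apply/andP; split; last by rewrite lerBlDl H.
by rewrite lerNl opprB lerBlDl -enormN opprB H.
Qed.

(** The distance to a set need not be attained: distance at most [e] only provides points nearer
    than [r], for any [r > e]. *)
Lemma enlarge_superlevel e u : e < r ->
  enlarge [set x | u < f x] e `<=` [set x | u < sup_ball f r x].
Proof.
move=> er x /= xe.
have : (ereal_inf [set (enorm (x - a))%:E | a in [set y | (u < f y)%R]] < r%:E)%E.
  by apply: le_lt_trans xe _; rewrite lte_fin.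
move=> /ereal_inf_lt[_ [a /= ua <-]]; rewrite lte_fin => xar.
apply: lt_le_trans ua _; have -> : a = x + (a - x) by rewrite addrC subrK.
by apply: sup_ball_ub; rewrite -enormN opprB.
Qed.

End sup_ball.

(** A limsup below [s] bounds the quotients on a whole punctured neighbourhood. The slope says
    nothing about the centre, which [0 <= s] covers. *)
Lemma sup_ball_slope (R : realType) n (f : 'rV[R]_n -> R) x (s : R) :
  lip1 f -> 0 <= s -> (slope f x < s%:E)%E ->
  exists2 d, 0 < d & forall r, 0 < r -> r < d -> sup_ball f r x - f x <= s * r.
Proof.
move=> fl s0 /ereal_inf_lt[_ [V xV <-]] Vs.
have /nbhs_ballP[d /= d0 dV] : nbhs x (fun y => y != x -> V y) by [].
exists d => // r r0 rd; rewrite lerBlDl; apply: sup_ball_le => // z zr.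
have [z0|z0] := eqVneq (enorm z) 0.
  apply: le_trans (lip1D fl x z) _; rewrite z0 lerD2l mulr_ge0//; exact: ltW.
have zx : x + z != x.
  move: (z0); apply: contra => /eqP xz; suff -> : z = 0 by rewrite enorm0.
  by apply: (addrI x); rewrite xz addr0.
(* The ball of radius [d] is one of the sup norm; it contains the Euclidean ball of the same
   radius. *)
have Vz : V (x + z).
  apply: dV zx; split => // i j; rewrite /ball/= mxE opprD addNKr normrN (ord1 i).
  by apply: le_lt_trans (coord_le_enorm z j) _; exact: lt_trans rd.
have : ((`|f x - f (x + z)| / enorm (x - (x + z)))%:E <= s%:E)%E.
  by apply: le_trans (ltW Vs); apply: ereal_sup_ubound; exists (x + z).
have zp : 0 < enorm z by rewrite lt_neqAle eq_sym z0 enorm_ge0.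
rewrite opprD addNKr enormN lee_fin ler_pdivrMr// distrC => /(le_trans (ler_norm _)).
rewrite lerBlDl => /le_trans; apply; rewrite lerD2l ler_wpM2l//; exact: ltW.
Qed.

Lemma enlarge_suplevel (R : realType) n (f : 'rV[R]_n -> R) (e u : R) :
  lip1 f -> enlarge [set x | u <= f x] e `<=` [set x | u - e <= f x].
Proof.
move=> fl x /= xe; apply/ler_addgt0Pr => k k0.
have : (ereal_inf [set (enorm (x - a))%:E | a in [set y | (u <= f y)%R]] < (e + k)%:E)%E.
  by apply: le_lt_trans xe _; rewrite lte_fin ltrDl.
move=> /ereal_inf_lt[_ [a /= ua <-]]; rewrite lte_fin => xar.
have := lip1D fl x (a - x); rewrite addrC subrK -enormN opprB; lra.
Qed.

Lemma sub_enlarge (R : realType) n (A : set 'rV[R]_n) e :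
  0 <= e -> A `<=` enlarge A e.
Proof.
move=> e0 x Ax; rewrite /enlarge/=; apply: (@le_trans _ _ 0%E); last by rewrite lee_fin.
by apply: ereal_inf_lbound; exists x => //; rewrite subrr enorm0.
Qed.

(** A countable intersection of open sets, each a union of Euclidean balls centred in [A] with
    radius slightly larger than [e]. *)
Lemma measurable_enlarge (R : realType) n (A : set 'rV[R]_n) e :
  measurable (enlarge A e : set (borel_rV R n)).
Proof.
have -> : enlarge A e =
    \bigcap_k \bigcup_(a in A) [set x : 'rV[R]_n | enorm (x - a) < e + k.+1%:R^-1].
  apply/seteqP; split => x /=.
    move=> xe k _.
    have : (ereal_inf [set (enorm (x - a))%:E | a in A] < (e + k.+1%:R^-1)%:E)%E.
      by apply: le_lt_trans xe _; rewrite lte_fin ltrDl invr_gt0.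
    by move=> /ereal_inf_lt[_ [a /= ua <-]]; rewrite lte_fin => xar; exists a.
  move=> H; rewrite /enlarge/=; apply/lee_addgt0Pr => k k0.
  have [m _ /(_ m (leqnn m)) mk] := near_infty_natSinv_lt (PosNum k0).
  have [a Aa ax] := H m I; apply: (@le_trans _ _ (enorm (x - a))%:E).
    by apply: ereal_inf_lbound; exists a.
  by rewrite -EFinD lee_fin ltW// (lt_trans ax)// ltrD2l.
apply: bigcapT_measurable => k; apply: sub_sigma_algebra.
apply: bigcup_open => a _.
rewrite (_ : [set x | _] = (fun x : 'rV[R]_n => enorm (x - a)) @^-1` [set y | y < e + k.+1%:R^-1])//.
by move: (@enorm_sub_continuous R n a) => /continuousP; apply; exact: open_lt.
Qed.

(** * The isoperimetric inequality *)

Section cheeger.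
Variables (R : realType) (n : nat) (nu : probability (borel_rV R n) R).
Variables (alpha I : R).
Hypotheses (alpha0 : 0 < alpha) (I0 : 0 < I).
Hypothesis cI : (cheeger nu alpha <= I%:E)%E.

Lemma bdry_measure_ge0 (A : set (borel_rV R n)) :
  measurable A -> (0 <= bdry_measure nu A)%E.
Proof.
move=> mA; rewrite /bdry_measure limf_einfE.
apply: le_trans; last first.
  apply: ereal_sup_ubound; exists [set e : R | 0 < e] => //.
  exact: nbhs_right_gt.
apply: le_ereal_inf_tmp => _ [e /= e0 <-].
apply: mule_ge0; last by rewrite inver gt_eqF// lee_fin invr_ge0 ltW.
have mAe := @measurable_enlarge R n A e.
rewrite sube_ge0 ?fin_num_measure//; apply: (@le_measure _ _ _ nu); rewrite ?inE//.
exact: (sub_enlarge (ltW e0)).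
Qed.

(** The Cheeger bound solved for the boundary measure; [nu A <= 1/2] selects [nu A] in the minimum.
    For [alpha = 1/(q+1)] it reads [nu(A)^(q+1) <= J nu(A^+)]. *)
Lemma cheeger_bdry_measure (A : set (borel_rV R n)) :
  measurable A -> (nu A <= 2^-1%:E)%E ->
  (((fine (nu A) / I) `^ alpha^-1)%:E <= bdry_measure nu A)%E.
Proof.
move=> mA A2; have b0 := bdry_measure_ge0 mA.
have nuA : nu A \is a fin_num by exact: fin_num_measure.
have : (Order.min (nu A) (1 - nu A) / (bdry_measure nu A) `^ alpha <= I%:E)%E.
  by apply: le_trans cI; apply: ereal_sup_ubound; exists A.
move: A2; rewrite -(fineK nuA); set a := fine (nu A).
have a0 : 0 <= a by rewrite fine_ge0.
rewrite lee_fin => A2.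
have -> : (Order.min a%:E (1 - a%:E) = a%:E)%E.
  by rewrite -EFinB min_l// lee_fin; lra.
case: (bdry_measure nu A) b0 => [b| |]//=; last by move=> *; rewrite leey.
(* If [b = 0], the ratio is [+oo] unless [a = 0], and the bound by [I] excludes [+oo]. *)
rewrite !lee_fin => b0; have [->|bN0] := eqVneq b 0.
  rewrite powR0 ?gt_eqF//. rewrite inver eqxx.
  have [->|aN0] := eqVneq a 0; first by rewrite mul0r powR0// invr_eq0 gt_eqF.
  have ap : 0 < a by rewrite lt_neqAle eq_sym aN0.
  by rewrite gt0_muley ?lte_fin// leye_eq.
have bp : 0 < b by rewrite lt_neqAle eq_sym bN0.
have B0 : 0 < b `^ alpha by exact: powR_gt0.
rewrite inver gt_eqF// -EFinM lee_fin ler_pdivrMr// => H.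
have -> : b = (b `^ alpha) `^ alpha^-1 by rewrite -powRrM divff ?gt_eqF// powRr1.
apply: ge0_ler_powR; rewrite ?nnegrE ?invr_ge0 ?powR_ge0 ?divr_ge0 ?(ltW alpha0) ?(ltW I0)//.
by rewrite ler_pdivrMr// mulrC.
Qed.

(** A value strictly below a liminf is eventually a lower bound; this is the form of the hypothesis
    of [dini_powRN_growth]. *)
Lemma cheeger_enlarge (A : set (borel_rV R n)) c :
  measurable A -> (nu A <= 2^-1%:E)%E ->
  c < (fine (nu A) / I) `^ alpha^-1 ->
  exists2 d : R, 0 < d & forall e : R, 0 < e -> e < d ->
    c * e <= fine (nu (enlarge A e)) - fine (nu A).
Proof.
move=> mA A2 cA; have : (c%:E < bdry_measure nu A)%E.
  by apply: lt_le_trans (cheeger_bdry_measure mA A2); rewrite lte_fin.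
rewrite /bdry_measure limf_einfE => /ereal_sup_gt[_ [V V0 <-] cV].
have [d /= d0 dV] := V0; exists d => // e e0 ed.
have Ve : V e by apply: dV => //=; rewrite sub0r normrN gtr0_norm.
have : (c%:E < (nu (enlarge A e) - nu A) / e%:E)%E.
  by apply: lt_le_trans cV _; apply: ereal_inf_lbound; exists e.
have mE := @measurable_enlarge R n A e.
rewrite -(fineK (fin_num_measure nu _ mE)) -(fineK (fin_num_measure nu _ mA)).
rewrite inver gt_eqF// -EFinB -EFinM lte_fin ltr_pdivlMr// => /ltW.
by rewrite fineK ?fin_num_measure.
Qed.

End cheeger.

(** * Polynomial tails *)

(** [T] is the infimum of the levels where [mu <= delta], and [c] makes the line [c + b * t] pass
    through [delta ^ (- q)] at [T]. Growth before [T], where [mu > delta], forces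
    [b * T <= delta ^ (- q)], hence [c >= 0]; growth after [T] keeps [mu ^ (- q)] above the line. *)
Lemma growth_tail (R : realType) (mu : R -> R) (q b delta : R) :
  0 < q -> 0 < b -> 0 < delta ->
  (forall t, 0 <= mu t) ->
  (forall s t, s <= t -> mu t <= mu s) ->
  (exists2 t, 0 < t & mu t <= delta) ->
  (forall s t, 0 < s -> s <= t -> 0 < mu t ->
    mu s `^ (- q) + b * (t - s) <= mu t `^ (- q)) ->
  exists T c, [/\ 0 <= T, 0 <= c, c + b * T = delta `^ (- q),
    forall s, 0 < s -> s < T -> delta < mu s &
    forall t, T < t -> mu t <= (c + b * t) `^ (- q^-1)].
Proof.
move=> q0 b0 d0 mu0 mum [t0 t00 mut0] growth.
pose E := [set t | 0 < t /\ mu t <= delta]; set T := inf E.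
have Elb : has_lbound E by exists 0 => t [/ltW].
have T0 : 0 <= T by apply: lb_le_inf => [|t [/ltW]//]; exists t0.
have powRNm x y : 0 < x -> x <= y -> y `^ (- q) <= x `^ (- q).
  move=> x0 xy; have y0 := lt_le_trans x0 xy.
  rewrite !powRN lef_pV2 ?posrE ?powR_gt0//.
  by apply: ge0_ler_powR; rewrite ?nnegrE ?(ltW q0) ?(ltW x0) ?(ltW y0).
have below s : 0 < s -> s < T -> delta < mu s.
  by move=> s0 sT; rewrite ltNge; apply/negP => /(conj s0)/(ge_inf Elb); rewrite -/T; lra.
have above t : T < t -> mu t <= delta.
  move=> /(inf_lt (ex_intro _ t0 (conj t00 mut0)))[z [_ zd] zt].
  by apply: le_trans zd; rewrite mum// ltW.
(* Growth is available only from positive levels and [mu > delta] only before [T], so both ends of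
   the interval are moved in by [k]. *)
have bT : b * T <= delta `^ (- q).
  apply/ler_addgt0Pr => e e0.
  have [T0'|T0'] := ltP 0 T; last first.
    have -> : T = 0 by apply/eqP; rewrite eq_le T0 T0'.
    by rewrite mulr0 addr_ge0 ?powR_ge0// ltW.
  pose k := Num.min (T / 4) (e / (2 * b)).
  have k0 : 0 < k by rewrite lt_min !divr_gt0// mulr_gt0.
  have k1 : k <= T / 4 by rewrite ge_min lexx.
  have k2 : 2 * (b * k) <= e.
    by rewrite mulrA mulrC -ler_pdivlMr ?mulr_gt0// ge_min lexx orbT.
  have mk : delta < mu (T - k) by apply: below; lra.
  have := @growth k (T - k) k0 ltac:(lra) (lt_trans d0 mk).
  have := powRNm _ _ d0 (ltW mk); have := powR_ge0 (mu k) (- q).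
  rewrite !mulrBr; lra.
exists T, (delta `^ (- q) - b * T); split => //; [by rewrite subr_ge0|by rewrite subrK|].
move=> t Tt; have [->|mut] := eqVneq (mu t) 0; first exact: powR_ge0.
have {}mut : 0 < mu t by rewrite lt_neqAle eq_sym mut mu0.
(* [mu T <= delta] may fail when [mu] jumps at [T]; growth therefore starts at [T + k]. *)
have H : delta `^ (- q) - b * T + b * t <= mu t `^ (- q).
  apply/ler_addgt0Pr => e e0.
  pose k := Num.min ((t - T) / 2) (e / b).
  have k0 : 0 < k by rewrite lt_min !divr_gt0// subr_gt0.
  have k1 : k <= (t - T) / 2 by rewrite ge_min lexx.
  have k2 : b * k <= e.
    by rewrite mulrC -ler_pdivlMr// ge_min lexx orbT.
  have mk : mu (T + k) <= delta by apply: above; lra.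
  have mk0 : 0 < mu (T + k) by apply: lt_le_trans mut _; apply: mum; lra.
  have := @growth (T + k) t ltac:(lra) ltac:(lra) mut.
  have := powRNm _ _ mk0 mk; rewrite !mulrBr !mulrDr; lra.
have c0 : 0 < delta `^ (- q) - b * T + b * t.
  have : 0 < delta `^ (- q) by rewrite powR_gt0.
  have : b * T < b * t by rewrite ltr_pM2l.
  lra.
have -> : mu t = (mu t `^ (- q)) `^ (- q^-1).
  by rewrite -powRrM mulrNN divff ?gt_eqF// powRr1// ltW.
rewrite !(powRN _ q^-1) lef_pV2 ?posrE ?powR_gt0//.
by apply: ge0_ler_powR; rewrite ?nnegrE ?invr_ge0 ?(ltW q0) ?(ltW c0) ?powR_ge0.
Qed.

Lemma ge0_integral_ccdf d (T : measurableType d) (R : realType)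
    (P : probability T R) (X : T -> R) :
  measurable_fun setT X -> (forall x, 0 <= X x) ->
  (\int[P]_x (X x)%:E =
   \int[@lebesgue_measure R]_(r in `[0%R, +oo[) P [set x | (r < X x)%R])%E.
Proof.
move=> mX X0; have := @ge0_expectation_ccdf d T R P (mfun_Sub (mem_set mX)) X0.
rewrite unlock => ->; apply: eq_integral => r _.
congr (P _); apply/seteqP; split => x /=; by rewrite in_itv/= andbT.
Qed.

Lemma measurable_ccdf d (T : measurableType d) (R : realType)
    (P : probability T R) (X : T -> R) (D : set R) :
  measurable_fun setT X ->
  measurable_fun D (fun r => P [set x | r < X x]).
Proof.
move=> mX; apply: measurable_funTS.
apply: eq_measurable_fun (@ccdf_measurable d T R P (mfun_Sub (mem_set mX))).
move=> r _; congr (P _); apply/seteqP; split => x /=; by rewrite in_itv/= andbT.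
Qed.

(** Layer-cake formula on the open half-line. In [tail_cutoff] the level [v = 0] corresponds to
    [t = T], where [growth_tail] bounds nothing. *)
Lemma le_integral_superlevel d (T : measurableType d) (R : realType)
    (P : probability T R) (X : T -> R) (F : R -> R) :
  measurable_fun setT X -> (forall x, 0 <= X x) -> measurable_fun setT F ->
  (forall v, 0 < v -> (P [set x | (v < X x)%R] <= (F v)%:E)%E) ->
  (\int[P]_x (X x)%:E <= \int[@lebesgue_measure R]_(v in `[0%R, +oo[) (F v)%:E)%E.
Proof.
move=> mX X0 mF XF; rewrite ge0_integral_ccdf//.
rewrite -integral_itv_obnd_cbnd; last exact: measurable_ccdf mX.
rewrite -integral_itv_obnd_cbnd; last first.
  by apply/measurable_EFinP; exact: measurable_funTS.
apply: ge0_le_integral => //.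
- exact: measurable_ccdf mX.
- by apply/measurable_EFinP; exact: measurable_funTS.
- by move=> v /=; rewrite in_itv/= andbT; exact: XF.
Qed.

Lemma powR_continuous (R : realType) (r x : R) : 0 < x -> {for x, continuous (@powR R ^~ r)}.
Proof.
move=> x0; apply: differentiable_continuous; apply/derivable1_diffP.
by have [] := @is_derive1_powR R r x x0.
Qed.

Lemma powRN_cvgy0 (R : realType) (r : R) : 0 < r -> x `^ (- r) @[x --> +oo] --> (0 : R).
Proof.
move=> r0; apply/cvgrPdist_lt => e e0; near=> x.
have x0 : 0 < x by near: x; exact: nbhs_pinfty_gt.
rewrite sub0r normrN ger0_norm ?powR_ge0//.
have ex : e `^ (- r^-1) < x by near: x; apply: nbhs_pinfty_gt; exact: num_real.
have -> : e = (e `^ (- r^-1)) `^ (- r).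
  by rewrite -powRrM mulrNN mulVf ?gt_eqF// powRr1// ltW.
have E0 : 0 < e `^ (- r^-1) by exact: powR_gt0.
rewrite !(powRN _ r) ltf_pV2 ?posrE ?powR_gt0//.
by apply: gt0_ltr_powR; rewrite ?nnegrE ?(ltW E0) ?(ltW x0).
Unshelve. all: by end_near. Qed.

Section integral_powRN_sqrt.
Variables (R : realType) (b c k T : R).
Hypotheses (b0 : 0 < b) (c0 : 0 <= c) (k2 : 2 < k) (T0 : 0 <= T).
Hypothesis y0 : 0 < c + b * T.

Let Z v := c + b * Num.sqrt (T ^+ 2 + v).
(** Substituting [z = Z v] gives [dv = 2 (z - c) / b^2 dz]; [G] is the primitive of
    [2 / b^2 * (z^(1-k) - c z^(-k))] that vanishes at infinity. *)
Let G z := 2 / b ^+ 2 * (c / (k - 1) * z `^ (1 - k) - (k - 2)^-1 * z `^ (2 - k)).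

Let Z0 : Z 0 = c + b * T.
Proof. by rewrite /Z addr0 sqrtr_sqr ger0_norm. Qed.

Let Z_gt0 (v : R) : 0 <= v -> 0 < Z v.
Proof.
move=> v0; apply: lt_le_trans y0 _; rewrite -Z0 lerD2l ler_pM2l//.
by rewrite ler_wsqrtr// lerD2l.
Qed.

Let Z_continuous : continuous Z.
Proof.
move=> v; apply: cvgD; first exact: cvg_cst.
apply: cvgMr; apply: (@continuous_comp _ _ _ (fun v => T ^+ 2 + v) Num.sqrt).
  by apply: cvgD; [exact: cvg_cst|exact: cvg_id].
exact: sqrt_continuous.
Qed.

Let Z_cvgy : Z v @[v --> +oo] --> +oo.
Proof.
apply/cvgryPge => A; near=> v.
have v0 : 0 <= v by near: v; exact: nbhs_pinfty_ge.
have vA : ((A - c) / b) ^+ 2 <= v by near: v; apply: nbhs_pinfty_ge; exact: num_real.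
suff : (A - c) / b <= Num.sqrt (T ^+ 2 + v) by rewrite ler_pdivrMr// /Z; lra.
apply: le_trans (ler_norm _) _; rewrite -sqrtr_sqr ler_wsqrtr//.
by apply: le_trans vA _; rewrite lerDr sqr_ge0.
Unshelve. all: by end_near. Qed.

Let dZ (v : R) : 0 < v -> is_derive v (1 : R) Z (b / (2 * Num.sqrt (T ^+ 2 + v))).
Proof.
move=> v0; have w0 : 0 < T ^+ 2 + v by rewrite ltr_wpDl// sqr_ge0.
have dw : is_derive v (1 : R) (fun v : R => T ^+ 2 + v) (0 + 1).
  exact: (@is_deriveD _ _ _ (cst (T ^+ 2)) id v 1 0 1 _ _).
have ds := @is_derive1_comp R Num.sqrt _ _ _ _ (is_derive1_sqrt w0) dw.
have := @is_deriveD _ _ _ (cst c) _ v 1 0 _ _ (@is_deriveZ _ _ _ _ b v 1 _ ds).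
rewrite !add0r mulr1 /GRing.scale/=; exact.
Qed.

Let dG (z : R) : 0 < z -> is_derive z (1 : R) G (2 / b ^+ 2 * (z `^ (- k) * (z - c))).
Proof.
move=> z0.
have d1 := @is_deriveZ _ _ _ _ (c / (k - 1)) z 1 _ (is_derive1_powR (1 - k) z0).
have d2 := @is_deriveZ _ _ _ _ (k - 2)^-1 z 1 _ (is_derive1_powR (2 - k) z0).
have := @is_deriveZ _ _ _ _ (2 / b ^+ 2) z 1 _ (@is_deriveB _ _ _ _ _ z 1 _ _ d1 d2).
rewrite /GRing.scale/=.
move=> /is_derive_eq; apply; congr (_ * _).
have -> : 2 - k - 1 = 1 + - k by ring.
have -> : 1 - k - 1 = - k by ring.
have -> : z `^ (1 + - k) = z * z `^ (- k).
  by rewrite powRD ?(gt_eqF z0) ?implybT// powRr1 ?(ltW z0).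
have k1N : k - 1 != 0 by rewrite lt0r_neq0// subr_gt0 (lt_trans _ k2)// ltr1n.
have k2N : k - 2 != 0 by rewrite lt0r_neq0// subr_gt0.
by field; rewrite k1N k2N.
Qed.

(** [Num.sqrt (T ^+ 2 + v)] is the value of [g] at which [g^2 - T^2] equals [v]: this integrates the
    polynomial tail beyond [T]. *)
Lemma integral_powRN_sqrt :
  (\int[@lebesgue_measure R]_(v in `[0%R, +oo[)
      ((c + b * Num.sqrt (T ^+ 2 + v)) `^ (- k))%:E
   <= (2 / (b ^+ 2 * (k - 2)) * (c + b * T) `^ (2 - k))%:E)%E.
Proof.
have zc v : {for v, continuous Z} by exact: Z_continuous.
have Gc z : 0 < z -> {for z, continuous G}.
  move=> z0; apply: differentiable_continuous; apply/derivable1_diffP.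
  by have [] := dG z0.
rewrite (@ge0_continuous_FTC2y R (fun v => Z v `^ (- k)) (G \o Z) 0 0).
- rewrite sub0e -EFinN lee_fin /= Z0 /G.
  have y1 := powR_ge0 (c + b * T) (1 - k).
  (* This term enters [- G (Z 0)] with a minus sign and is dropped, by [0 <= c]. *)
  have : 0 <= 2 / b ^+ 2 * (c / (k - 1) * (c + b * T) `^ (1 - k)).
    apply: mulr_ge0; first by rewrite divr_ge0// exprn_ge0// ltW.
    by rewrite mulr_ge0// divr_ge0// subr_ge0; have := k2; lra.
  rewrite mulrBr opprB invfM !mulrA; lra.
- by move=> x _; exact: powR_ge0.
- apply: continuous_in_subspaceT => x; rewrite inE/= in_itv/= andbT => x0.
  apply: (@continuous_comp _ _ _ Z (fun z => z `^ (- k))); first exact: zc.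
  by apply: powR_continuous; exact: Z_gt0.
- apply: (@cvg_comp _ _ _ Z G); first exact: Z_cvgy.
  rewrite (_ : (0 : R) = 2 / b ^+ 2 * (c / (k - 1) * 0 - (k - 2)^-1 * 0)); last by rewrite !mulr0 subr0 mulr0.
  apply: cvgMr; apply: cvgB; apply: cvgMr.
    by rewrite -(opprK (1 - k)); apply: powRN_cvgy0; have := k2; lra.
  by rewrite -(opprK (2 - k)); apply: powRN_cvgy0; have := k2; lra.
- move=> x x0; have [] // := @is_derive1_comp R G Z x _ _ (dG (Z_gt0 (ltW x0))) (dZ x0).
- apply: cvg_at_right_filter; apply: (@continuous_comp _ _ _ Z G); first exact: zc.
  by apply: Gc; exact: Z_gt0.
- move=> x; rewrite in_itv/= andbT => x0; rewrite derive1E.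
  have dF := @is_derive1_comp R G Z x _ _ (dG (Z_gt0 (ltW x0))) (dZ x0).
  rewrite (@derive_val _ _ _ _ _ _ _ dF).
  have s0 : 0 < Num.sqrt (T ^+ 2 + x) by rewrite sqrtr_gt0 ltr_wpDl// sqr_ge0.
  set z := Z x `^ (- k); rewrite /Z addrAC subrr add0r.
  by field; rewrite !gt_eqF.
Qed.

End integral_powRN_sqrt.

Section one_tail.
Variables (R : realType) (n : nat) (nu : probability (borel_rV R n) R).
Variables (q I : R) (g : 'rV[R]_n -> R).
Hypotheses (q0 : 0 < q) (I0 : 0 < I).
Hypothesis cI : (cheeger nu (q + 1)^-1 <= I%:E)%E.
Hypothesis gl : lip1 g.
Hypothesis g2 : (nu [set x | (0 < g x)%R] <= 2^-1%:E)%E.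

Let J := I `^ (q + 1).
Let mu t := fine (nu [set x | t <= g x]).

Lemma measurable_superlevel (f : 'rV[R]_n -> R) u :
  lip1 f -> measurable ([set x | u < f x] : set (borel_rV R n)).
Proof.
move=> /lip1_measurable mf; rewrite -[X in measurable X]setTI.
rewrite (_ : [set x | _] = f @^-1` `]u, +oo[); first exact: mf.
by apply/seteqP; split => x /=; rewrite in_itv/= andbT.
Qed.

Lemma measurable_suplevel (f : 'rV[R]_n -> R) u :
  lip1 f -> measurable ([set x | u <= f x] : set (borel_rV R n)).
Proof.
move=> /lip1_measurable mf; rewrite -[X in measurable X]setTI.
rewrite (_ : [set x | _] = f @^-1` `[u, +oo[); first exact: mf.
by apply/seteqP; split => x /=; rewrite in_itv/= andbT.
Qed.

Lemma le_fine_probability (A B : set (borel_rV R n)) :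
  measurable A -> measurable B -> A `<=` B -> fine (nu A) <= fine (nu B).
Proof.
move=> mA mB AB; apply: fine_le; rewrite ?fin_num_measure//.
by apply: (@le_measure _ _ _ nu); rewrite ?inE.
Qed.

(** Positive levels keep [{g >= x}] inside [{g > 0}], hence of measure at most 1/2, as the Cheeger
    bound requires. *)
Lemma tail_growth s t : 0 < s -> s <= t -> 0 < mu t ->
  mu s `^ (- q) + q / J * (t - s) <= mu t `^ (- q).
Proof.
move=> s0 st mut; apply: dini_powRN_growth => //.
- exact: powR_gt0.
- move=> x y _ xy _; apply: le_fine_probability; try exact: measurable_suplevel.
  by move=> z /=; exact: le_trans.
- move=> x c sx xt c0 cx; have mA := measurable_suplevel x gl.
  have nuA : (nu [set y | (x <= g y)%R] <= 2^-1%:E)%E.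
    apply: le_trans g2; apply: (@le_measure _ _ _ nu); rewrite ?inE//.
      exact: measurable_superlevel.
    by move=> y /=; apply: lt_le_trans; exact: lt_trans sx.
  have q1 : 0 < (q + 1)^-1 by rewrite invr_gt0 addr_gt0.
  have cA : c < (fine (nu [set y | x <= g y]) / I) `^ (q + 1)^-1^-1.
    rewrite invrK powRM ?invr_ge0 ?(ltW I0) ?fine_ge0//.
    by rewrite -(powR_inv1 (ltW I0)) powRAC powR_inv1// powR_ge0.
  have [d d0 dP] := cheeger_enlarge q1 I0 cI mA nuA cA.
  exists d => // e e0 ed; apply: le_trans (dP _ e0 ed) _; rewrite lerD2r.
  apply: le_fine_probability; [exact: measurable_enlarge|exact: measurable_suplevel|].
  exact: enlarge_suplevel.
Qed.

Lemma tail_vanish delta : 0 < delta -> exists2 t, 0 < t & mu t <= delta.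
Proof.
move=> d0; pose X : {RV nu >-> R} := mfun_Sub (mem_set (lip1_measurable gl)).
have := cvg_ccdfy0 X => /fine_cvgP[_ /cvgrPdist_lt/(_ _ d0)[M [_ HM]]].
pose t := Num.max M 0 + 1.
have Mt : M < t by rewrite /t ltr_pwDr// le_max lexx.
have t0 : 0 < t by rewrite /t ltr_pwDr// le_max lexx orbT.
exists (t + 1); first by rewrite addr_gt0.
have := HM _ Mt; rewrite sub0r normrN => /ltW; apply: le_trans.
apply: le_trans (ler_norm _); apply: le_fine_probability.
- exact: measurable_suplevel.
- have := measurable_superlevel t gl; congr measurable.
  by apply/seteqP; split => x /=; rewrite in_itv/= andbT.
- by move=> x /= tx; rewrite in_itv/= andbT; apply: lt_le_trans tx; rewrite ltrDl.
Qed.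

(** [integral_powRN_sqrt] with [b = q / J] and [k = 1/q]: the requirement [2 < k] is [q < 1/2], and
    [(delta^(-q))^(2 - 1/q) = delta^(1 - 2q)]. *)
Lemma tail_cutoff delta : 0 < delta -> q < 2^-1 -> exists T, [/\ 0 <= T,
    forall s, 0 < s -> s < T -> delta < mu s &
    (\int[nu]_x (Num.max (Num.max (g x) 0 ^+ 2 - T ^+ 2) 0)%:E <=
      (2 * J ^+ 2 / (q * (1 - 2 * q)) * delta `^ (1 - 2 * q))%:E)%E].
Proof.
move=> d0 q2; have J0 : 0 < J by exact: powR_gt0.
have b0 : 0 < q / J by rewrite divr_gt0.
have [T [c [T0 c0 cT below above]]] : exists T c, [/\ 0 <= T, 0 <= c,
    c + q / J * T = delta `^ (- q), forall s, 0 < s -> s < T -> delta < mu s &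
    forall t, T < t -> mu t <= (c + q / J * t) `^ (- q^-1)].
  apply: growth_tail => //; last exact: tail_growth.
  - by move=> t; rewrite fine_ge0.
  - move=> s t st; apply: le_fine_probability; try exact: measurable_suplevel.
    by move=> z /=; exact: le_trans.
  - exact: tail_vanish.
exists T; split => //.
have mg := lip1_measurable gl.
have y0 : 0 < c + q / J * T by rewrite cT powR_gt0.
have k2 : 2 < q^-1 by rewrite -[2]invrK ltf_pV2// posrE invr_gt0.
pose F v := (c + q / J * Num.sqrt (T ^+ 2 + v)) `^ (- q^-1).
apply: (@le_trans _ _ (\int[@lebesgue_measure R]_(v in `[0%R, +oo[) (F v)%:E)%E).
  apply: le_integral_superlevel.
  - apply: measurable_maxr => //; apply: measurable_funB => //.
    by apply: measurable_funX; apply: measurable_maxr.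
  - by move=> x; rewrite le_max lexx orbT.
  - apply: (measurableT_comp (f := fun z : R => z `^ (- q^-1))).
      exact: measurable_powR.
    apply: measurable_funD => //; apply: measurable_funM => //.
    apply: continuous_measurable_fun => w.
    apply: (@continuous_comp _ _ _ (fun v => T ^+ 2 + v) Num.sqrt).
      by apply: cvgD; [exact: cvg_cst|exact: cvg_id].
    exact: sqrt_continuous.
  - move=> v v0; set t := Num.sqrt (T ^+ 2 + v).
    have Tt : T < t.
      rewrite -(ger0_norm T0) -sqrtr_sqr ltr_sqrt ?ltrDl//.
      by rewrite ltr_wpDl// sqr_ge0.
    have mt := measurable_suplevel t gl.
    apply: (@le_trans _ _ (mu t)%:E); last by rewrite lee_fin; exact: above.
    rewrite fineK ?fin_num_measure//.
    have w0 : 0 < T ^+ 2 + v by rewrite ltr_wpDl// sqr_ge0.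
    have t0 : 0 < t by rewrite sqrtr_gt0.
    have -> : [set x | v < Num.max (Num.max (g x) 0 ^+ 2 - T ^+ 2) 0]
        = [set x | t < g x].
      apply/seteqP; split => x /=; rewrite lt_max [v < 0]ltNge (ltW v0) orbF ltrBrDl.
        move=> H; have : t < Num.max (g x) 0.
          have m0 : 0 <= Num.max (g x) 0 by rewrite le_max lexx orbT.
          by rewrite -(ger0_norm m0) -sqrtr_sqr ltr_sqrt// (lt_trans w0).
        by rewrite lt_max [t < 0]ltNge (ltW t0) orbF.
      move=> tg; rewrite max_l ?(ltW (lt_trans t0 tg))//.
      by rewrite -[T ^+ 2 + v]sqr_sqrtr ?(ltW w0)// ltr_sqr ?nnegrE ?(ltW t0) ?(ltW (lt_trans t0 tg)).
    apply: (@le_measure _ _ _ nu); rewrite ?inE//; first exact: measurable_superlevel.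
    by move=> x /= /ltW.
  apply: le_trans (integral_powRN_sqrt b0 c0 k2 T0 y0) _.
  rewrite lee_fin cT -powRrM.
  have -> : - q * (2 - q^-1) = 1 - 2 * q by field; rewrite gt_eqF.
  apply: ler_wpM2r; first exact: powR_ge0.
  rewrite le_eqVlt; apply/orP; left; apply/eqP; field.
  by rewrite !gt_eqF// subr_gt0 mulrC -ltr_pdivlMr// mul1r.
Qed.

End one_tail.

(** * Upper slopes *)

Lemma integral_cst_probability d (T : measurableType d) (R : realType)
    (P : probability T R) (c : \bar R) : (\int[P]_x (cst c x) = c)%E.
Proof.
rewrite integral_cst// -[RHS]mule1; congr (_ * _)%E; exact: probability_setT.
Qed.

(** The integral of a nonnegative function is a supremum over simple functions below it. This allows
    comparison with [energy], whose integrand is not shown to be measurable. *)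
Lemma ge0_le_integralT d (T : measurableType d) (R : realType)
    (P : {measure set T -> \bar R}) (f1 f2 : T -> \bar R) :
  (forall x, 0 <= f1 x)%E -> (forall x, f1 x <= f2 x)%E ->
  (\int[P]_x f1 x <= \int[P]_x f2 x)%E.
Proof.
move=> f10 f12; have f20 x : (0 <= f2 x)%E by exact: le_trans (f12 x).
rewrite !ge0_integralTE//; apply: ereal_sup_le => _ [h hf <-].
by exists h => // x; exact: le_trans (f12 x).
Qed.

Lemma le_integral_affine d (T : measurableType d) (R : realType)
    (P : probability T R) (X Y Z : T -> R) (a b c r : R) :
  measurable_fun setT X -> measurable_fun setT Y ->
  (forall x, 0 <= X x) -> (forall x, 0 <= Y x) -> (forall x, 0 <= Z x) ->
  0 <= a -> 0 <= b -> 0 <= c -> 0 <= r ->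
  (forall x, Z x <= X x + r * (a * Y x + b * X x + c)) ->
  (\int[P]_x (Z x)%:E <= \int[P]_x (X x)%:E +
    r%:E * (a%:E * \int[P]_x (Y x)%:E + b%:E * \int[P]_x (X x)%:E + c%:E))%E.
Proof.
move=> /measurable_EFinP mX /measurable_EFinP mY X0 Y0 Z0 a0 b0 c0 r0 H.
rewrite -[in leRHS](integral_cst_probability P c%:E).
have ma : measurable_fun setT (fun x => a%:E * (Y x)%:E)%E by exact: measurable_funeM.
have mb : measurable_fun setT (fun x => b%:E * (X x)%:E)%E by exact: measurable_funeM.
rewrite -!ge0_integralZl ?lee_fin//; last 2 first.
- by move=> x _; rewrite lee_fin.
- by move=> x _; rewrite lee_fin.
rewrite -ge0_integralD//; last 2 first.
- by move=> x _; rewrite -EFinM lee_fin mulr_ge0.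
- by move=> x _; rewrite -EFinM lee_fin mulr_ge0.
have mab : measurable_fun setT (fun x => a%:E * (Y x)%:E + b%:E * (X x)%:E)%E.
  exact: emeasurable_funD.
have ab0 x : (0 <= a%:E * (Y x)%:E + b%:E * (X x)%:E)%E.
  by rewrite -!EFinM -EFinD lee_fin addr_ge0// mulr_ge0.
rewrite -ge0_integralD//.
have mabc : measurable_fun setT
    (fun x => a%:E * (Y x)%:E + b%:E * (X x)%:E + cst c%:E x)%E.
  exact: emeasurable_funD.
have abc0 x : (0 <= a%:E * (Y x)%:E + b%:E * (X x)%:E + cst c%:E x)%E.
  by rewrite adde_ge0// lee_fin.
rewrite -ge0_integralZl ?lee_fin//.
rewrite -ge0_integralD//; last 3 first.
- by move=> x _; rewrite lee_fin.
- by move=> x _; rewrite mule_ge0// lee_fin.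
- exact: measurable_funeM.
by apply: ge0_le_integralT => x; rewrite lee_fin.
Qed.

Lemma limn_einf_ge (R : realType) (u : (\bar R)^nat) (l : R) :
  (forall c, c < l -> \forall k \near \oo, (c%:E <= u k)%E) ->
  (l%:E <= limn_einf u)%E.
Proof.
move=> H; apply/lee_addgt0Pr => e e0.
rewrite -leeBlDr//; have : l - e < l by rewrite ltrBlDr ltrDl.
move/H => uk; change (limn_einf u) with (limf_einf u \oo); rewrite limf_einfE.
apply: le_trans; last first.
  by apply: ereal_sup_ubound; exists [set k | ((l - e)%:E <= u k)%E].
by apply: le_ereal_inf_tmp => _ [k /= + <-].
Qed.

Lemma limn_esup_le (R : realType) (u : (\bar R)^nat) (c : \bar R) :
  (\forall k \near \oo, (u k <= c)%E) -> (limn_esup u <= c)%E.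
Proof.
move=> uc; apply: (@le_trans _ _ (ereal_sup (u @` [set k | (u k <= c)%E]))).
  by apply: ereal_inf_lbound; exists [set k | (u k <= c)%E].
by apply: ge_ereal_sup => _ [k /= + <-].
Qed.

Lemma measurable_limn_einf d (T : measurableType d) (R : realType) (D : set T)
    (f : (T -> \bar R)^nat) : (forall k, measurable_fun D (f k)) ->
  measurable_fun D (fun x => limn_einf (f ^~ x)).
Proof.
move=> mf; apply: measurableT_comp => //.
apply: (@measurable_fun_limn_esup _ _ _ _ (fun k x => - f k x)%E) => k.
exact: measurableT_comp.
Qed.

Section incr.
Variables (R : realType) (n : nat) (f : 'rV[R]_n -> R).
Hypothesis fl : lip1 f.

Let r k : R := k.+1%:R^-1.
(** A measurable, [[0, 1]]-valued replacement for the slope at scale [1/(k+1)]. *)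
Definition sup_ball_incr k x := (sup_ball f (r k) x - f x) / r k.

Let r0 k : 0 < r k. Proof. by rewrite invr_gt0. Qed.

Lemma sup_ball_incr_ge0 k x : 0 <= sup_ball_incr k x.
Proof. by rewrite divr_ge0 ?(ltW (r0 k))// subr_ge0 sup_ball_ge. Qed.

Lemma sup_ball_incr_le1 k x : sup_ball_incr k x <= 1.
Proof. by rewrite ler_pdivrMr// mul1r lerBlDl sup_ball_leD. Qed.

Lemma measurable_sup_ball_incr k :
  measurable_fun [set: borel_rV R n] (sup_ball_incr k).
Proof.
apply: measurable_funM => //; apply: measurable_funB; apply: lip1_measurable => //.
exact: sup_ball_lip1.
Qed.

Lemma limn_esup_incr_le_slope x :
  (limn_esup (fun k => (sup_ball_incr k x ^+ 2)%:E) <= slope f x ^+ 2)%E.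
Proof.
have H s : 0 <= s -> (slope f x < s%:E)%E ->
    (limn_esup (fun k => (sup_ball_incr k x ^+ 2)%:E) <= (s ^+ 2)%:E)%E.
  move=> s0 /(sup_ball_slope fl s0)[d d0 dP]; apply: limn_esup_le.
  near=> k; rewrite lee_fin ler_sqr ?nnegrE ?sup_ball_incr_ge0//.
  rewrite ler_pdivrMr//; apply: dP => //.
  by near: k; exact: (near_infty_natSinv_lt (PosNum d0)).
(* Both infinite values have square [+oo]. *)
move: (slope f x) H => [s| |] H; last 2 first.
  by rewrite expe2 mulyy leey.
  by rewrite expe2 mulNyNy leey.
have H2 : (limn_esup (fun k => (sup_ball_incr k x ^+ 2)%:E)
    <= ((Num.max s 0) ^+ 2)%:E)%E.
  set m := Num.max s 0; have m0 : 0 <= m by rewrite le_max lexx orbT.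
  apply/lee_addgt0Pr => e e0.
  (* For [k <= 1], [(m + k)^2 <= m^2 + k (2 m + 1) <= m^2 + e]. *)
  pose k := Num.min 1 (e / (2 * m + 1)).
  have k0 : 0 < k by rewrite lt_min ltr01 divr_gt0// ltr_wpDl// mulr_ge0.
  have k1 : k <= 1 by rewrite ge_min lexx.
  have k2 : k * (2 * m + 1) <= e.
    by rewrite -ler_pdivlMr ?ge_min ?lexx ?orbT// ltr_wpDl// mulr_ge0.
  apply: le_trans (H (m + k) _ _) _.
  - by rewrite addr_ge0// ltW.
  - by rewrite lte_fin ltr_pwDr// le_max lexx.
  - by rewrite -EFinD lee_fin; nra.
apply: le_trans H2 _; rewrite -EFin_expe lee_fin.
by have [_|_] := leP s 0; rewrite // expr2 mul0r sqr_ge0.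
Unshelve. all: by end_near. Qed.

(* Unlike [energy], this is at most 1 even in dimension 0, where the slope is
   -oo and its square +oo. *)
Definition upper_energy (nu : probability (borel_rV R n) R) : \bar R :=
  (\int[nu]_x limn_esup (fun k => (sup_ball_incr k x ^+ 2)%:E))%E.

Let incr2_ge0 x k : (0 <= (sup_ball_incr k x ^+ 2)%:E)%E.
Proof. by rewrite lee_fin sqr_ge0. Qed.

Let incr2_le1 x k : ((sup_ball_incr k x ^+ 2)%:E <= 1)%E.
Proof. by rewrite lee_fin expr_le1// ?sup_ball_incr_le1// sup_ball_incr_ge0. Qed.

Let limn_esup_incr2_ge0 x :
  (0 <= limn_esup (fun k => (sup_ball_incr k x ^+ 2)%:E))%E.
Proof.
apply: le_trans (limn_einf_sup _); apply: (@limn_einf_ge R _ 0) => c c0.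
by apply: nearW => k; apply: le_trans (incr2_ge0 x k); rewrite lee_fin ltW.
Qed.

Lemma upper_energy_ge0 nu : (0 <= upper_energy nu)%E.
Proof. by apply: integral_ge0 => x _; exact: limn_esup_incr2_ge0. Qed.

Lemma upper_energy_le1 nu : (upper_energy nu <= 1)%E.
Proof.
rewrite -(integral_cst_probability nu 1%E); apply: ge0_le_integralT => x.
  exact: limn_esup_incr2_ge0.
by apply: limn_esup_le; apply: nearW => k; exact: incr2_le1.
Qed.

Lemma upper_energy_le_energy nu : (upper_energy nu <= energy nu f)%E.
Proof.
apply: ge0_le_integralT => x; first exact: limn_esup_incr2_ge0.
exact: limn_esup_incr_le_slope.
Qed.

(** Reverse Fatou: the tail suprema [esups] converge to the limsup and are dominated by the constant
    1, so their integrals eventually fall below [e]. *)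
Lemma integral_incr_lt (nu : probability (borel_rV R n) R) (e : R) :
  (upper_energy nu < e%:E)%E ->
  \forall k \near \oo, (\int[nu]_x (sup_ball_incr k x ^+ 2)%:E < e%:E)%E.
Proof.
pose h k x := (sup_ball_incr k x ^+ 2)%:E.
have h0 k x : (0 <= h k x)%E := incr2_ge0 x k.
have h1 k x : (h k x <= 1)%E := incr2_le1 x k.
have mh k : measurable_fun [set: borel_rV R n] (h k).
  by apply/measurable_EFinP; apply: measurable_funX; exact: measurable_sup_ball_incr.
move=> Le.
have es0 x k : (0 <= esups (h ^~ x) k)%E.
  by apply: le_trans (h0 k x) _; apply: ereal_sup_ubound; exists k => /=.
have dom : {ae nu, forall x k, setT x -> `|esups (h ^~ x) k| <= (EFin \o cst (1 : R)%R) x}%E.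
  apply: aeW => x k _; rewrite gee0_abs//.
  by apply: ge_ereal_sup => _ [j _ <-]; exact: h1.
have cvg : {ae nu, forall x, setT x ->
    (fun k x => esups (h ^~ x) k) ^~ x @ \oo --> limn_esup (h ^~ x)}.
  by apply: aeW => x _; rewrite limn_esup_lim; exact: is_cvg_esups.
have [_ _ dc] := dominated_convergence measurableT (measurable_fun_esups mh)
  (measurable_fun_limn_esup mh) cvg (finite_measure_integrable_cst _ _ measurableT) dom.
have : \forall k \near \oo, (\int[nu]_x esups (h ^~ x) k < e%:E)%E.
  exact: (dc _ (open_ereal_lt' Le)).
apply: filterS => k; apply: le_lt_trans.
apply: ge0_le_integral => //.
- exact: mh.
- exact: (measurable_fun_esups mh k).
- by move=> x _; apply: ereal_sup_ubound; exists k => /=.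
Qed.

End incr.

(** * The truncated second moment *)

(** A discrete chain rule for the square. Truncation is nondecreasing and 1-Lipschitz, so [h'^2 -
    h^2 = (h' - h)(2 h + (h' - h)) <= r d (2 h + r)]; the last summand [r] is the second-order
    error. *)
Lemma sqr_truncation_incr (R : realType) (y y' T r l : R) :
  0 <= T -> 0 < r -> 0 < l -> y <= y' -> y' <= y + r ->
  Num.min (Num.max y' 0) T ^+ 2 <= Num.min (Num.max y 0) T ^+ 2
    + r * (l * ((y' - y) / r) ^+ 2 + l^-1 * Num.min (Num.max y 0) T ^+ 2 + r).
Proof.
move=> T0 r0 l0 yy' y'r.
set h := Num.min (Num.max y 0) T; set h' := Num.min (Num.max y' 0) T.
have h0 : 0 <= h by rewrite le_min le_max lexx orbT.
have [hh' h'h] : h <= h' /\ h' - h <= y' - y.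
  rewrite /h /h' !minElt !maxElt.
  by do !case: ifPn; rewrite -?leNgt => *; split; lra.
set d := (y' - y) / r.
have dE : y' - y = r * d by rewrite mulrC divfK// gt_eqF.
have d0 : 0 <= d by rewrite divr_ge0 ?subr_ge0// ltW.
have d1 : d <= 1 by rewrite ler_pdivrMr// mul1r lerBlDl.
(* AM-GM with weight [l] *)
have amgm : 2 * h * d <= l * d ^+ 2 + l^-1 * h ^+ 2.
  have : 0 <= l^-1 * (l * d - h) ^+ 2 by rewrite mulr_ge0 ?sqr_ge0// invr_ge0 ltW.
  rewrite sqrrB exprMn mulrDr mulrBr -!mulrnAr.
  have -> : l^-1 * (l ^+ 2 * d ^+ 2) = l * d ^+ 2 by field; rewrite gt_eqF.
  have -> : l^-1 * (l * d * (h *+ 2)) = 2 * h * d by rewrite -mulr_natl; field; rewrite gt_eqF.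
  lra.
have e1 : h' ^+ 2 - h ^+ 2 = (h' - h) * (2 * h + (h' - h)) by ring.
have e2 : (h' - h) * (2 * h + (h' - h)) <= r * d * (2 * h + r).
  apply: ler_pM; rewrite ?subr_ge0//; first by rewrite addr_ge0 ?mulr_ge0 ?subr_ge0.
    by rewrite -dE.
  by rewrite lerD2l (le_trans h'h)// lerBlDl.
have e3 : r * d * (2 * h + r) <= r * (l * d ^+ 2 + l^-1 * h ^+ 2 + r).
  rewrite -mulrA ler_pM2l// mulrDr.
  have : d * r <= r by rewrite ger_pMl.
  have -> : d * (2 * h) = 2 * h * d by ring.
  lra.
lra.
Qed.

Section truncated_tail.
Variables (R : realType) (n : nat) (nu : probability (borel_rV R n) R).
Variables (q I : R) (g : 'rV[R]_n -> R).
Hypotheses (q0 : 0 < q) (I0 : 0 < I).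
Hypothesis cI : (cheeger nu (q + 1)^-1 <= I%:E)%E.
Hypothesis gl : lip1 g.
Hypothesis g2 : (nu [set x | (0 < g x)%R] <= 2^-1%:E)%E.

Variables (delta T e : R).
Hypotheses (delta0 : 0 < delta) (T0 : 0 <= T).
Hypothesis below :
  forall s, 0 < s -> s < T -> delta < fine (nu [set x | s <= g x]).

Let r k : R := k.+1%:R^-1.
Let r0 k : 0 < r k. Proof. by rewrite invr_gt0. Qed.
Let gk k := sup_ball g (r k).
Let gkl k : lip1 (gk k). Proof. exact: sup_ball_lip1. Qed.
Let tr (y : R) := Num.min (Num.max y 0) T ^+ 2.
Let B := delta `^ (- q) * I `^ (q + 1).

Let tr_gt u y : 0 <= u -> u < T ^+ 2 -> (u < tr y) = (Num.sqrt u < y).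
Proof.
move=> u0 uT; rewrite /tr -{1}[u]sqr_sqrtr// ltr_sqr ?nnegrE ?sqrtr_ge0//; last first.
  by rewrite le_min le_max lexx orbT T0.
rewrite lt_min lt_max [_ < 0]ltNge sqrtr_ge0 orbF.
suff -> : Num.sqrt u < T by rewrite andbT.
by rewrite -(ger0_norm T0) -sqrtr_sqr ltr_sqrt// (le_lt_trans u0).
Qed.

Let tr_le y : tr y <= T ^+ 2.
Proof. by rewrite ler_sqr ?nnegrE ?ge_min ?lexx ?orbT// le_min le_max lexx orbT T0. Qed.

Let trm y y' : y <= y' -> tr y <= tr y'.
Proof.
move=> yy'; rewrite ler_sqr ?nnegrE; last 2 first.
- by rewrite le_min le_max lexx orbT T0.
- by rewrite le_min le_max lexx orbT T0.
by rewrite le_min !ge_min lexx orbT andbT ge_max !le_max lexx yy' orbT.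
Qed.

Let mtr (f : 'rV[R]_n -> R) : lip1 f ->
  measurable_fun [set: borel_rV R n] (fun x => tr (f x)).
Proof.
move=> /lip1_measurable mf; apply: measurable_funX; apply: measurable_minr => //.
exact: measurable_maxr.
Qed.

Let mlev (f : 'rV[R]_n -> R) u : lip1 f ->
  measurable ([set x | u < tr (f x)] : set (borel_rV R n)).
Proof.
move=> /mtr mf; rewrite -[X in measurable X]setTI.
rewrite (_ : [set x | _] = (fun x => tr (f x)) @^-1` `]u, +oo[); first exact: mf.
by apply/seteqP; split => x /=; rewrite in_itv/= andbT.
Qed.

Let A u := nu [set x | (u < tr (g x))%R].
Let Ak k u := nu [set x | (u < tr (gk k x))%R].

Let A_le k u : (A u <= Ak k u)%E.
Proof.
apply: (@le_measure _ _ _ nu); rewrite ?inE; [exact: mlev|exact: mlev|].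
by move=> x /= /lt_le_trans; apply; apply: trm; exact: sup_ball_ge.
Qed.

(** The linear isoperimetric inequality for [{X > u}]. The quotient is taken at [e = 1/(k+2)],
    strictly below the radius [1/(k+1)] of [gk k], because [enlarge_superlevel] needs a strict
    inequality. *)
Lemma superlevel_le_liminf u : 0 <= u ->
  (A u <= B%:E * limn_einf (fun k => (Ak k u - A u) * k.+2%:R%:E))%E.
Proof.
move=> u0; have mA := mlev u gl; have fA : A u \is a fin_num by exact: fin_num_measure.
have B0 : 0 <= B by rewrite mulr_ge0 ?powR_ge0.
have [uT|Tu] := ltP u (T ^+ 2); last first.
  have -> : A u = 0%E.
    rewrite /A (_ : [set x | _] = set0) ?measure0//.
    by apply/seteqP; split => x //=; rewrite ltNge (le_trans (tr_le _)).
  apply: mule_ge0 => //; apply: (@limn_einf_ge _ _ 0) => c c0.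
  apply: nearW => k; apply: (@le_trans _ _ 0%E); first by rewrite lee_fin ltW.
  by apply: mule_ge0 => //; rewrite sube0 measure_ge0.
have uT' : Num.sqrt u < T.
  by rewrite -(ger0_norm T0) -sqrtr_sqr ltr_sqrt// (le_lt_trans u0).
have AE : [set x | u < tr (g x)] = [set x | Num.sqrt u < g x].
  by apply/seteqP; split => x /=; rewrite tr_gt.
have su0 := sqrtr_ge0 u.
(* The midpoint of [Num.sqrt u] and [T] is positive even for [u = 0], is below [T], and its closed
   superlevel set lies in [{g > Num.sqrt u}]. *)
pose a := fine (A u); have da : delta < a.
  apply: lt_le_trans (below (s := (Num.sqrt u + T) / 2) _ _) _; [lra|lra|].
  apply: le_fine_probability => //; first exact: measurable_suplevel.
  by rewrite AE => x /=; apply: lt_le_trans; lra.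
have a0 : 0 < a by exact: lt_trans da.
have A2 : (A u <= 2^-1%:E)%E.
  apply: le_trans g2; apply: (@le_measure _ _ _ nu); rewrite ?inE//.
    exact: measurable_superlevel.
  by rewrite AE => x /=; exact: le_lt_trans.
(* The powers of [I] cancel, leaving [a <= (a / delta)^q * a]. *)
have aB : a <= B * (a / I) `^ (q + 1).
  have ai : 0 <= I^-1 by rewrite invr_ge0 ltW.
  rewrite powRM ?(ltW a0)// -(powR_inv1 (ltW I0)) -powRrM mulN1r powRN.
  rewrite /B mulrA [_ * a `^ _]mulrAC mulfK ?gt_eqF ?powR_gt0//.
  rewrite powRD ?(gt_eqF a0) ?implybT// powRr1 ?(ltW a0)// mulrA.
  rewrite ler_peMl ?(ltW a0)// powRN mulrC ler_pdivlMr ?powR_gt0// mul1r.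
  by apply: ge0_ler_powR; rewrite ?nnegrE ?(ltW q0) ?(ltW delta0) ?(ltW a0) ?(ltW da).
have q1 : 0 < (q + 1)^-1 by rewrite invr_gt0 addr_gt0.
rewrite -(fineK fA); apply: (@le_trans _ _ (B%:E * ((a / I) `^ (q + 1))%:E)%E).
  by rewrite -EFinM lee_fin.
apply: lee_wpmul2l; first by rewrite lee_fin.
apply: limn_einf_ge => c; rewrite -{1}(invrK (q + 1)).
move=> /(cheeger_enlarge q1 I0 cI mA A2)[d d0 dP].
near=> k.
have e0 : 0 < k.+2%:R^-1 :> R by rewrite invr_gt0.
have ed : k.+2%:R^-1 < d.
  apply: (@le_lt_trans _ _ (k.+1%:R^-1)); first by rewrite lef_pV2 ?posrE// ler_nat.
  by near: k; exact: (near_infty_natSinv_lt (PosNum d0)).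
have mAk := mlev u (gkl k).
have := dP _ e0 ed; rewrite ler_pdivrMr// -lee_fin => /le_trans; apply.
rewrite EFinM; apply: lee_wpmul2r; first by rewrite lee_fin.
rewrite -(fineK fA) /Ak -(fineK (fin_num_measure nu _ mAk)) -EFinB lee_fin lerD2r.
apply: le_fine_probability => //; first exact: measurable_enlarge.
have -> : [set x | u < tr (gk k x)] = [set x | Num.sqrt u < gk k x].
  by apply/seteqP; split => x /=; rewrite tr_gt.
rewrite AE; apply: enlarge_superlevel => //.
by rewrite ltf_pV2 ?posrE// ltr_nat.
Unshelve. all: by end_near. Qed.

Hypothesis fe : (upper_energy g nu < e%:E)%E.

Let X x := tr (g x).
Let Xk k x := tr (gk k x).

(** By the layer-cake formula the left side is [E[Xk] - E[X]], and [E[X] <= T^2] is finite and can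
    be cancelled; the bound integrates [sqr_truncation_incr]. *)
Lemma integral_superlevel_diff l : 0 < l ->
  \forall k \near \oo,
   (\int[@lebesgue_measure R]_(u in `[0%R, +oo[) (Ak k u - A u) <=
    (r k * (l * e + l^-1 * fine (\int[nu]_x (X x)%:E) + r k))%:E)%E.
Proof.
move=> l0; have := integral_incr_lt gl fe; apply: filterS => k Ek.
have mX := mtr gl; have mXk := mtr (gkl k).
have X0 x : 0 <= X x by exact: sqr_ge0.
have Xk0 x : 0 <= Xk k x by exact: sqr_ge0.
have S0 : (0 <= \int[nu]_x (X x)%:E)%E by apply: integral_ge0 => x _; rewrite lee_fin.
have Sfin : (\int[nu]_x (X x)%:E)%E \is a fin_num.
  rewrite ge0_fin_numE//.
  apply: (@le_lt_trans _ _ (\int[nu]_x (cst (T ^+ 2)%:E x))%E).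
    by apply: ge0_le_integralT => x; rewrite lee_fin; [exact: X0|exact: tr_le].
  by rewrite integral_cst_probability ltry.
have E1 : (\int[nu]_x (Xk k x)%:E = \int[nu]_x (X x)%:E
    + \int[@lebesgue_measure R]_(u in `[0%R, +oo[) (Ak k u - A u))%E.
  rewrite !ge0_integral_ccdf// -ge0_integralD//.
  - by apply: eq_integral => u _; rewrite addeC subeK// fin_num_measure//; exact: mlev.
  - exact: measurable_ccdf mX.
  - by move=> u _; rewrite sube_ge0 ?A_le// fin_num_measure//; exact: mlev.
  - apply: emeasurable_funB; [exact: measurable_ccdf mXk|exact: measurable_ccdf mX].
pose d2 x := sup_ball_incr g k x ^+ 2.
have md2 : measurable_fun [set: borel_rV R n] d2.
  by apply: measurable_funX; exact: measurable_sup_ball_incr.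
have E2 : (\int[nu]_x (Xk k x)%:E <= \int[nu]_x (X x)%:E
    + (r k)%:E * (l%:E * \int[nu]_x (d2 x)%:E
       + l^-1%:E * \int[nu]_x (X x)%:E + (r k)%:E))%E.
  apply: le_integral_affine => //.
  - by move=> x; exact: sqr_ge0.
  - exact: ltW.
  - by rewrite invr_ge0 ltW.
  - exact: ltW.
  - exact: ltW.
  - move=> x; rewrite /Xk /X /d2 /sup_ball_incr /tr.
    by apply: sqr_truncation_incr => //; [exact: sup_ball_ge|exact: sup_ball_leD].
move: E2; rewrite E1 leeD2lE//; move=> /le_trans; apply.
rewrite -(fineK Sfin) EFinM; apply: lee_wpmul2l; first by rewrite lee_fin ltW.
rewrite !EFinD !EFinM; do 2 apply: leeD => //.
by apply: lee_wpmul2l; [rewrite lee_fin ltW|exact: ltW].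
Qed.

(** Integrating [superlevel_le_liminf] over [u] and applying Fatou leaves the liminf of the
    integrals bounded in [integral_superlevel_diff], taken with [l = 2 * B]. *)
Lemma truncated_second_moment :
  (\int[nu]_x (X x)%:E <= (4 * B ^+ 2 * e)%:E)%E.
Proof.
have X0 x : 0 <= X x by exact: sqr_ge0.
have mX := mtr gl.
have B0 : 0 < B by rewrite mulr_gt0 ?powR_gt0.
have Sfin : (\int[nu]_x (X x)%:E)%E \is a fin_num.
  rewrite ge0_fin_numE; last by apply: integral_ge0 => x _; rewrite lee_fin.
  apply: (@le_lt_trans _ _ (\int[nu]_x (cst (T ^+ 2)%:E x))%E).
    by apply: ge0_le_integralT => x; rewrite lee_fin; [exact: X0|exact: tr_le].
  by rewrite integral_cst_probability ltry.
have e0 : 0 <= e.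
  by rewrite -lee_fin; apply: le_trans (ltW fe); exact: upper_energy_ge0.
pose s := fine (\int[nu]_x (X x)%:E).
have s0 : 0 <= s by apply: fine_ge0; apply: integral_ge0 => x _; rewrite lee_fin.
pose D k u := ((Ak k u - A u) * k.+2%:R%:E)%E.
have D0 k u : (0 <= D k u)%E.
  by rewrite mule_ge0// sube_ge0 ?A_le// fin_num_measure//; exact: mlev.
have mD k : measurable_fun (`[0%R, +oo[ : set R) (D k).
  apply: emeasurable_funM => //.
  by apply: emeasurable_funB; [exact: measurable_ccdf (mtr (gkl k))|exact: measurable_ccdf mX].
have mDi : measurable_fun (`[0%R, +oo[ : set R) (fun u => limn_einf (D ^~ u)).
  exact: measurable_limn_einf.
have Di0 u : (0 <= limn_einf (D ^~ u))%E.
  by apply: (@limn_einf_ge _ _ 0) => c c0; apply: nearW => k; apply: le_trans (D0 k u); rewrite lee_fin ltW.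
have H1 : (s%:E <= B%:E * limn_einf (fun k => \int[@lebesgue_measure R]_(u in `[0%R, +oo[) D k u))%E.
  rewrite fineK// ge0_integral_ccdf//.
  apply: (@le_trans _ _ (\int[@lebesgue_measure R]_(u in `[0%R, +oo[) (B%:E * limn_einf (D ^~ u)))%E).
    apply: ge0_le_integral => //.
    - exact: measurable_ccdf mX.
    - exact: measurable_funeM.
    - by move=> u /=; rewrite in_itv/= andbT => u0; exact: superlevel_le_liminf.
  rewrite ge0_integralZl ?lee_fin ?(ltW B0)//.
  apply: lee_wpmul2l; first by rewrite lee_fin ltW.
  exact: fatou.
pose W := 2 * B * e + (2 * B)^-1 * s.
have lB : 0 < 2 * B by exact: mulr_gt0.
have W0 : 0 <= W.
  by apply: addr_ge0; apply: mulr_ge0; rewrite ?invr_ge0 ?(ltW lB).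
have H2 c : W < c -> s <= B * c.
  move=> Wc; rewrite -lee_fin; apply: le_trans H1 _.
  rewrite (EFinM B c); apply: lee_wpmul2l; first by rewrite lee_fin ltW.
  apply: le_trans (limn_einf_sup _) _; apply: limn_esup_le.
  (* With [r = r k <= 1], [(k + 2) * r = 1 + r], and [(1 + r)(W + r) <= W + r (W + 2)], which is at
     most [c] for this bound on [r]. *)
  have W2 : 0 < (c - W) / (W + 2) by rewrite divr_gt0 ?subr_gt0 ?ltr_wpDl.
  have := integral_superlevel_diff lB; apply: filter_app.
  near=> k; move=> Hk.
  have rk : r k <= (c - W) / (W + 2).
    by apply: ltW; near: k; exact: (near_infty_natSinv_lt (PosNum W2)).
  rewrite (_ : (\int[@lebesgue_measure R]_(u in `[0%R, +oo[) D k u =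
    k.+2%:R%:E * \int[@lebesgue_measure R]_(u in `[0%R, +oo[) (Ak k u - A u))%E); last first.
    rewrite -ge0_integralZl ?lee_fin//.
    - by apply: eq_integral => u _; rewrite /D muleC.
    - by apply: emeasurable_funB; [exact: measurable_ccdf (mtr (gkl k))|exact: measurable_ccdf mX].
    - by move=> u _; rewrite sube_ge0 ?A_le// fin_num_measure//; exact: mlev.
  apply: le_trans (lee_wpmul2l _ Hk) _; first by rewrite lee_fin.
  rewrite -/s -/W -EFinM lee_fin.
  have -> : k.+2%:R = (1 + r k) / r k :> R.
    rewrite /r invrK mulrDl mul1r mulVf ?gt_eqF ?ltr0n// -natr1 addrC; congr (_ + _).
  have rk1 : r k <= 1 by rewrite invf_le1 ?ltr0n// ler1n.
  have rk0 := r0 k.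
  rewrite mulrA divfK ?gt_eqF//.
  move: rk; rewrite ler_pdivlMr ?ltr_wpDl// => rk.
  have rr : r k * r k <= r k by rewrite ger_pMr.
  have -> : (1 + r k) * (W + r k) = W + (r k * W + r k + r k * r k) by ring.
  by move: rk; rewrite mulrDr; lra.
have H3 : s <= B * W.
  apply/ler_addgt0Pr => t t0.
  apply: le_trans (H2 (W + t / B) _) _; first by rewrite ltrDl divr_gt0.
  by rewrite mulrDr mulrCA divff ?mulr1 ?gt_eqF.
rewrite -(fineK Sfin) lee_fin -/s.
have : B * W = 2 * B ^+ 2 * e + s / 2 by rewrite /W; field; rewrite gt_eqF.
lra.
Unshelve. all: by end_near. Qed.

End truncated_tail.

(** * Assembling the two tails *)

Section two_tails.
Variables (R : realType) (n : nat) (nu : probability (borel_rV R n) R).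
Variables (q I e : R).
Hypotheses (q0 : 0 < q) (q2 : q < 2^-1) (I0 : 0 < I) (e0 : 0 < e).
Hypothesis cI : (cheeger nu (q + 1)^-1 <= I%:E)%E.

Let c := (q * (1 - 2 * q))^-1.

Let c_gt0 : 0 < c.
Proof.
by rewrite invr_gt0 mulr_gt0// subr_gt0 -ltr_pdivlMl// mulr1.
Qed.

Lemma tail_second_moment (g : 'rV[R]_n -> R) :
  lip1 g -> (nu [set x | (0 < g x)%R] <= 2^-1%:E)%E ->
  (upper_energy g nu < e%:E)%E ->
  (\int[nu]_x (Num.max (g x) 0 ^+ 2)%:E
   <= (4 * I `^ (2 * (q + 1)) * c * (2 * e / c) `^ (1 - 2 * q))%:E)%E.
Proof.
move=> gl g2 ge.
(* This probability level balances the bounds for the two parts of [g]. *)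
set delta := 2 * e / c; set J2 := I `^ (2 * (q + 1)).
have d0 : 0 < delta by rewrite divr_gt0// mulr_gt0.
have [T [T0 below tail]] := tail_cutoff q0 I0 cI gl g2 d0 q2.
have core := truncated_second_moment q0 I0 cI gl g2 d0 T0 below ge.
have mg := lip1_measurable gl.
have mg0 : measurable_fun [set: borel_rV R n] (fun x => Num.max (g x) 0).
  exact: measurable_maxr.
have -> : (\int[nu]_x (Num.max (g x) 0 ^+ 2)%:E =
   \int[nu]_x (Num.min (Num.max (g x) 0) T ^+ 2)%:E +
   \int[nu]_x (Num.max (Num.max (g x) 0 ^+ 2 - T ^+ 2) 0)%:E)%E.
  rewrite -ge0_integralD//.
  - apply: eq_integral => x _; rewrite -EFinD; congr (_%:E).
    have m0 : 0 <= Num.max (g x) 0 by rewrite le_max lexx orbT.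
    move: (Num.max _ _) m0 => m m0; have [mT|Tm] := leP m T.
      by rewrite max_r ?addr0// subr_le0 ler_sqr.
    by rewrite max_l ?subrKC// subr_ge0 ler_sqr// ltW.
  - by move=> x _; rewrite lee_fin sqr_ge0.
  - by apply/measurable_EFinP; apply: measurable_funX; exact: measurable_minr.
  - by move=> x _; rewrite lee_fin le_max lexx orbT.
  - apply/measurable_EFinP; apply: measurable_maxr => //.
    by apply: measurable_funB => //; exact: measurable_funX.
apply: le_trans (leeD core tail) _.
have J2E : I `^ (q + 1) ^+ 2 = J2.
  by rewrite /J2 mulrC powRrM powR_mulrn// powR_ge0.
have de : e = delta * c / 2 by rewrite /delta; field; rewrite gt_eqF.
have dE : delta `^ (- q) ^+ 2 * delta = delta `^ (1 - 2 * q).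
  rewrite -powR_mulrn ?powR_ge0// -powRrM -{2}(powRr1 (ltW d0)) -powRD; last first.
    by rewrite (gt_eqF d0) implybT.
  by congr (_ `^ _); ring.
(* With [e = delta * c / 2], each of the two bounds equals [2 * c * J2 * delta^(1 - 2q)]. *)
rewrite -EFinD lee_fin le_eqVlt; apply/orP; left; apply/eqP.
rewrite exprMn J2E {1}de -dE -/c /c; field.
by rewrite !gt_eqF// subr_gt0 -ltr_pdivlMl// mulr1.
Qed.

(** The alternative [1 < e] serves energies above 1, possibly infinite: [upper_energy] is at most 1
    in any case. Both [f - m] and [m - f] have the slope of [f]. *)
Lemma two_tails_second_moment (f : 'rV[R]_n -> R) (m : R) :
  lip1 f ->
  (nu [set x | (m < f x)%R] <= 2^-1%:E)%E ->
  (nu [set x | (f x < m)%R] <= 2^-1%:E)%E ->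
  (energy nu f < e%:E)%E || (1 < e) ->
  (\int[nu]_x (`|f x - m| ^+ 2)%:E
   <= (8 * I `^ (2 * (q + 1)) * c * (2 * e / c) `^ (1 - 2 * q))%:E)%E.
Proof.
move=> fl mf fm fe.
have ue (g : 'rV[R]_n -> R) : lip1 g -> (forall x y, `|g x - g y| = `|f x - f y|) ->
    (upper_energy g nu < e%:E)%E.
  move=> gl gf; case/orP: fe => fe.
    apply: le_lt_trans (upper_energy_le_energy gl nu) _; apply: le_lt_trans fe.
    suff -> : energy nu g = energy nu f by [].
    apply: eq_integral => x _; congr (limf_esup _ _ ^+ 2)%E.
    by apply/funext => y; rewrite gf.
  by apply: le_lt_trans (upper_energy_le1 gl nu) _; rewrite lte_fin.
have g1 (x y : 'rV[R]_n) : `|(f x - m) - (f y - m)| = `|f x - f y|.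
  by congr `|_|; ring.
have g2 (x y : 'rV[R]_n) : `|(m - f x) - (m - f y)| = `|f x - f y|.
  by rewrite -normrN; congr `|_|; ring.
have l1 : lip1 (fun x => f x - m) by move=> x y; rewrite g1.
have l2 : lip1 (fun x => m - f x) by move=> x y; rewrite g2.
have t1 : (nu [set x | (0 < f x - m)%R] <= 2^-1%:E)%E.
  by under eq_set do rewrite subr_gt0.
have t2 : (nu [set x | (0 < m - f x)%R] <= 2^-1%:E)%E.
  by under eq_set do rewrite subr_gt0.
have T1 := tail_second_moment l1 t1 (ue _ l1 g1).
have T2 := tail_second_moment l2 t2 (ue _ l2 g2).
have -> : (\int[nu]_x (`|f x - m| ^+ 2)%:E =
   \int[nu]_x (Num.max (f x - m) 0 ^+ 2)%:E +
   \int[nu]_x (Num.max (m - f x) 0 ^+ 2)%:E)%E.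
  have ml (g : 'rV[R]_n -> R) : lip1 g ->
      measurable_fun [set: borel_rV R n] (fun x => (Num.max (g x) 0 ^+ 2)%:E).
    move=> /lip1_measurable mg; apply/measurable_EFinP; apply: measurable_funX.
    exact: measurable_maxr.
  rewrite -ge0_integralD//; last 4 first.
  - by move=> x _; rewrite lee_fin sqr_ge0.
  - exact: ml l1.
  - by move=> x _; rewrite lee_fin sqr_ge0.
  - exact: ml l2.
  apply: eq_integral => x _; rewrite -EFinD real_normK ?num_real//; congr (_%:E).
  rewrite -(opprB (f x) m); move: (f x - m) => z.
  have [z0|z0] := leP z 0.
    by rewrite max_l ?oppr_ge0// sqrrN [0 ^+ 2]expr2 mul0r add0r.
  by rewrite max_r ?oppr_le0 ?(ltW z0)// [0 ^+ 2]expr2 mul0r addr0.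
apply: le_trans (leeD T1 T2) _; rewrite -EFinD lee_fin le_eqVlt; apply/orP; left.
by apply/eqP; ring.
Qed.

End two_tails.

(** * Medians of Lipschitz functions *)

Section median.
Variables (R : realType) (n : nat) (nu : probability (borel_rV R n) R).

(** Continuity from below along the levels [u + 1/(k+1)]. *)
Lemma superlevel_le_right (g : 'rV[R]_n -> R) (u b : R) : lip1 g ->
  (forall v, u < v -> (nu [set x | (v < g x)%R] <= b%:E)%E) ->
  (nu [set x | (u < g x)%R] <= b%:E)%E.
Proof.
move=> gl H; pose F k := [set x | u + k.+1%:R^-1 < g x].
have mF k : measurable (F k : set (borel_rV R n)) by exact: measurable_superlevel.
have FE : [set x | u < g x] = \bigcup_k F k.
  apply/seteqP; split => x /=.
    rewrite -subr_gt0 => gu.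
    have [k _ /(_ k (leqnn k)) kg] := near_infty_natSinv_lt (PosNum gu).
    by exists k => //; rewrite /F/= -ltrBrDl.
  by move=> [k _]; apply: lt_trans; rewrite ltrDl invr_gt0.
have cv : nu (F k) @[k --> \oo] --> nu (\bigcup_k F k).
  apply: nondecreasing_cvg_mu => //; first exact: bigcupT_measurable.
  move=> i j ij; apply/subsetPset => x; apply: le_lt_trans.
  by rewrite lerD2l lef_pV2 ?posrE// ler_nat.
rewrite FE -(cvg_lim _ cv)//; apply: lime_le; first by apply/cvg_ex; eexists; exact: cv.
by apply: nearW => k; apply: H; rewrite ltrDl invr_gt0.
Qed.

Lemma superlevel_sublevel (g : 'rV[R]_n -> R) (u : R) : lip1 g ->
  nu [set x | (u < g x)%R] = (1 - nu [set x | (g x <= u)%R])%E.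
Proof.
move=> gl; have mg := measurable_superlevel u gl.
have -> : [set x | (g x <= u)%R] = ~` [set x | u < g x].
  by apply/seteqP; split => x /=; rewrite leNgt => /negP.
rewrite (@probability_setC _ _ _ nu)//.
by rewrite -(fineK (fin_num_measure nu _ mg)) -!EFinB; congr (_%:E); ring.
Qed.

(** Levels above the median are bounded below by an element of [E], levels below it are outside [E];
    both bounds pass to the median by [superlevel_le_right], applied to [f] and [- f]. *)
Lemma median_tails (f : 'rV[R]_n -> R) : lip1 f ->
  (nu [set x | (median nu f < f x)%R] <= 2^-1%:E)%E /\
  (nu [set x | (f x < median nu f)%R] <= 2^-1%:E)%E.
Proof.
move=> fl; have nfl : lip1 (fun x => - f x).
  by move=> x y; rewrite -opprD normrN; exact: fl.
set E := [set x : R | (2^-1%:E <= nu [set y | (f y <= x)%R])%E].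
have leE u : (nu [set x | (u < f x)%R] <= 2^-1%:E)%E <-> E u.
  rewrite superlevel_sublevel// /E/=.
  have mf : measurable ([set x | f x <= u] : set (borel_rV R n)).
    have := measurable_suplevel (- u) nfl; congr measurable.
    by apply/seteqP; split => x /=; rewrite lerN2.
  rewrite -(fineK (fin_num_measure nu _ mf)) -EFinB !lee_fin; split; lra.
(* [inf] is a genuine infimum only for a nonempty set bounded below; the vanishing tails of [f] and
   [- f] provide the two properties. *)
have E0 : E !=set0.
  have h0 : 0 < 2^-1 :> R by rewrite invr_gt0.
  have [t _ ht] := tail_vanish nu fl h0; exists t; apply/leE.
  have mt := measurable_suplevel t fl.
  apply: (@le_trans _ _ (nu [set x | t <= f x])).
    apply: (@le_measure _ _ _ nu); rewrite ?inE//; first exact: measurable_superlevel.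
    by move=> x /= /ltW.
  by rewrite -(fineK (fin_num_measure nu _ mt)) lee_fin.
have Elb : has_lbound E.
  (* Any value strictly below 1/2 excludes membership in [E]. *)
  have h0 : 0 < 4^-1 :> R by rewrite invr_gt0.
  have [t _ ht] := tail_vanish nu nfl h0; exists (- t) => x Ex.
  rewrite leNgt; apply/negP => xt; move: Ex; rewrite /E/=; apply/negP.
  have mt := measurable_suplevel t nfl.
  have mx : measurable ([set y | f y <= x] : set (borel_rV R n)).
    have := measurable_suplevel (- x) nfl; congr measurable.
    by apply/seteqP; split => y /=; rewrite lerN2.
  rewrite -ltNge; apply: (@le_lt_trans _ _ (nu [set y | t <= - f y])).
    apply: (@le_measure _ _ _ nu); rewrite ?inE// => y /= fx.
    by rewrite lerNr (le_trans fx)// ltW.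
  rewrite -(fineK (fin_num_measure nu _ mt)) lte_fin; apply: le_lt_trans ht _.
  by rewrite ltf_pV2 ?posrE// ltr_nat.
split.
  apply: superlevel_le_right => // v /(inf_lt E0)[z Ez zv]; 
  apply: (@le_trans _ _ (nu [set x | z < f x])); last exact/leE.
  apply: (@le_measure _ _ _ nu); rewrite ?inE; try exact: measurable_superlevel.
  by move=> x /=; exact: lt_trans.
have -> : [set x | f x < median nu f] = [set x | - median nu f < - f x].
  by apply/seteqP; split => x /=; rewrite ltrN2.
apply: superlevel_le_right => // v mv.
have nEv : ~ E (- v) by move=> /(ge_inf Elb); rewrite lerNr leNgt mv.
have {}nEv : (nu [set x | (f x <= - v)%R] <= 2^-1%:E)%E.
  by move: nEv => /negP; rewrite -ltNge => /ltW.
apply: le_trans nEv; apply: (@le_measure _ _ _ nu); rewrite ?inE.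
- exact: (measurable_superlevel v nfl).
- have := measurable_suplevel v nfl; congr measurable.
  by apply/seteqP; split => x /=; rewrite lerNr.
- by move=> x /= /ltW; rewrite lerNr.
Qed.

End median.

(** * The constant and the passage to the limit *)

(** In the variable [q] the bracket is [4 c I^(2(q+1))] with [c = 1/(q(1-2q))], raised to the power
    [2q]; the powers of 2 and of [I] then combine. *)
Lemma C2E (R : realType) (q I : R) : 0 < q -> q < 2^-1 -> 0 <= I ->
  C2 (q + 1)^-1 I =
    2 `^ (6 - 6 * q) * (q * (1 - 2 * q))^-1 `^ (2 * q) * I `^ (2 * (q + 1)).
Proof.
move=> q0 q2 I0; rewrite /C2; set a := (q + 1)^-1.
have q1 : q + 1 != 0 by rewrite gt_eqF// addr_gt0.
have qN : q != 0 by rewrite gt_eqF.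
have q2N : 1 - 2 * q != 0 by rewrite gt_eqF//; lra.
have c0 : 0 <= (q * (1 - 2 * q))^-1 by rewrite invr_ge0 mulr_ge0//; lra.
have aq : a = (q + 1)^-1 by [].
have -> : (16 * a - 10) / a = 6 - 10 * q by rewrite aq; field.
have -> : (6 * a - 4) / a ^+ 2 = (2 - 4 * q) * (q + 1) by rewrite aq; field.
have -> : 2 / a = 2 * (q + 1) by rewrite aq; field.
have -> : 2 * a ^+ 2 / ((3 * a - 2) * (1 - a)) = 2 * (q * (1 - 2 * q))^-1.
  by rewrite aq; field; rewrite q2N qN.
have -> : 2 * (1 - a) / a = 2 * q by rewrite aq; field.
move: (_^-1) c0 => c c0.
have X0 : 0 <= I `^ (2 * (q + 1)) by exact: powR_ge0.
have -> : 2 * I `^ (2 * (q + 1)) * (2 * c) = 2 `^ 2 * (c * I `^ (2 * (q + 1))).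
  by rewrite -[2 `^ 2]/(2 `^ 2%:R) powR_mulrn//; ring.
rewrite powRM ?mulr_ge0 ?powR_ge0// powRM// -!powRrM.
have -> : 2 `^ (6 - 6 * q) = 2 `^ (6 - 10 * q) * 2 `^ (2 * (2 * q)) :> R.
  by rewrite -powRD ?pnatr_eq0 ?implybT//; congr (_ `^ _); ring.
have -> : I `^ (2 * (q + 1)) =
    I `^ ((2 - 4 * q) * (q + 1)) * I `^ (2 * (q + 1) * (2 * q)).
  (* [I] may be 0, so adding exponents is justified by their sum being nonzero. *)
  rewrite -powRD; last first.
    have -> : (2 - 4 * q) * (q + 1) + 2 * (q + 1) * (2 * q) = 2 * (q + 1) by ring.
    by rewrite mulf_eq0 pnatr_eq0 (negbTE q1).
  by congr (_ `^ _); ring.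
ring.
Qed.

Lemma powR_right_continuous (R : realType) (t x : R) : 0 <= t -> 0 < x ->
  (t + s) `^ x @[s --> 0^'+] --> t `^ x.
Proof.
move=> t0 x0; have [->|tN0] := eqVneq t 0.
  rewrite powR0 ?gt_eqF//; under eq_fun do rewrite add0r; exact: powR_cvg0.
have tp : 0 < t by rewrite lt_neqAle eq_sym tN0.
apply: cvg_at_right_filter.
apply: (@cvg_comp _ _ _ (fun s => t + s) (fun z => z `^ x) _ (nbhs t)).
  by rewrite -{2}(addr0 t); apply: cvgD; [exact: cvg_cst|exact: cvg_id].
exact: powR_continuous.
Qed.

(** Extends the estimate from strictly larger parameters to [I] and [e] themselves, either of which
    may be 0; positive exponents give right-continuity there. *)
Lemma le_powR_limit (R : realType) (S : \bar R) (K I e x y : R) :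
  (0 <= S)%E -> 0 <= I -> 0 <= e -> 0 < x -> 0 < y ->
  (forall I' e', I < I' -> e < e' -> (S <= (K * I' `^ x * e' `^ y)%:E)%E) ->
  (S <= (K * I `^ x * e `^ y)%:E)%E.
Proof.
move=> S0 I0 e0 x0 y0 H.
have Sfin : S \is a fin_num.
  rewrite ge0_fin_numE//; apply: le_lt_trans (H (I + 1) (e + 1) _ _) _; rewrite ?ltrDl//.
  exact: ltry.
rewrite -(fineK Sfin) lee_fin.
have cv : K * (I + s) `^ x * (e + s) `^ y @[s --> 0^'+] --> K * I `^ x * e `^ y.
  apply: cvgM; last exact: powR_right_continuous.
  by apply: cvgMr; exact: powR_right_continuous.
apply: (cvgr_to_ge cv); near=> s.
have s0 : 0 < s by near: s; exact: nbhs_right_gt.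
by rewrite -lee_fin fineK//; apply: H; rewrite ltrDl.
Unshelve. all: by end_near. Qed.

Lemma cheeger_ge0 (R : realType) n (nu : probability (borel_rV R n) R) alpha :
  (0 <= cheeger nu alpha)%E.
Proof.
apply: ereal_sup_ubound; exists set0; first exact: measurable0.
by rewrite measure0 sube0 min_l// mul0e.
Qed.

Lemma sq_dev_le (R : realType) (n : nat) (nu : probability (borel_rV R n) R)
    (q I : R) (f : 'rV[R]_n -> R) :
  0 < q -> q < 2^-1 -> 0 <= I -> (cheeger nu (q + 1)^-1 <= I%:E)%E -> lip1 f ->
  (sq_dev nu f <= (C2 (q + 1)^-1 I)%:E * energy nu f `^ (1 - 2 * q))%E.
Proof.
move=> q0 q2 I0 cI fl; have q12 : 0 < 1 - 2 * q by lra.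
have C20 : 0 <= C2 (q + 1)^-1 I by rewrite /C2 !mulr_ge0 ?powR_ge0.
have en0 : (0 <= energy nu f)%E by apply: integral_ge0 => x _; exact: sqre_ge0.
(* Capping at 1 keeps [e] real when the energy is infinite, and any [e' > e] satisfies the
   alternative in [two_tails_second_moment]. *)
set e := fine (Order.min 1 (energy nu f))%E.
have minfin : (Order.min 1 (energy nu f))%E \is a fin_num.
  rewrite ge0_fin_numE ?le_min ?lee_fin ?ler01//.
  by apply: (@le_lt_trans _ _ 1%E); rewrite ?ge_min ?lexx// ltry.
have e0 : 0 <= e by rewrite fine_ge0// le_min en0 lee_fin ler01.
have eE : (e%:E <= energy nu f)%E by rewrite fineK// ge_min lexx orbT.
apply: (@le_trans _ _ ((C2 (q + 1)^-1 I)%:E * e%:E `^ (1 - 2 * q))%E); last first.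
  apply: lee_wpmul2l; first by rewrite lee_fin.
  by apply: gt0_ler_poweR; rewrite ?(ltW q12) ?in_itv/= ?lee_fin ?e0 ?en0 ?leey.
rewrite poweR_EFin -EFinM C2E//; set c := (q * (1 - 2 * q))^-1.
have c0 : 0 < c by rewrite invr_gt0 mulr_gt0.
have S0 : (0 <= sq_dev nu f)%E.
  by rewrite /sq_dev unlock; apply: integral_ge0 => x _; rewrite lee_fin sqr_ge0.
apply: le_powR_limit => //; first by rewrite mulr_gt0// addr_gt0.
move=> I' e' II' ee'; have I'0 := le_lt_trans I0 II'; have e'0 := le_lt_trans e0 ee'.
have cI' : (cheeger nu (q + 1)^-1 <= I'%:E)%E.
  by apply: le_trans cI _; rewrite lee_fin ltW.
have [mf fm] := median_tails nu fl.
have fe : (energy nu f < e'%:E)%E || (1 < e').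
  have : (Order.min 1 (energy nu f) < e'%:E)%E by rewrite -(fineK minfin) lte_fin.
  by rewrite gt_min lte_fin orbC.
have := two_tails_second_moment q0 q2 I'0 e'0 cI' fl mf fm fe.
rewrite /sq_dev unlock => /le_trans; apply; rewrite lee_fin -/c.
have c1 : 0 <= c^-1 by rewrite invr_ge0 ltW.
have e2 : 0 <= 2 * e' by rewrite mulr_ge0// ltW.
rewrite (powRM _ e2 c1) (powRM _ (ler0n _ 2) (ltW e'0)).
have cE : c * c^-1 `^ (1 - 2 * q) = c `^ (2 * q).
  rewrite -(powR_inv1 (ltW c0)) -powRrM -{1}(powRr1 (ltW c0)) -powRD.
    by congr (_ `^ _); ring.
  by rewrite (gt_eqF c0) implybT.
(* On exponents this is [4 - 2q <= 6 - 6q], that is, [q <= 1/2]. *)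
have two : 8 * 2 `^ (1 - 2 * q) <= 2 `^ (6 - 6 * q) :> R.
  have -> : 8 = 2 `^ 3%:R :> R by rewrite powR_mulrn//; ring.
  rewrite -powRD ?pnatr_eq0 ?implybT//; apply: ler_powR; first by rewrite ler1n.
  lra.
have -> : 8 * I' `^ (2 * (q + 1)) * c * (2 `^ (1 - 2 * q) * e' `^ (1 - 2 * q) * c^-1 `^ (1 - 2 * q))
  = (8 * 2 `^ (1 - 2 * q)) * (c * c^-1 `^ (1 - 2 * q) * (I' `^ (2 * (q + 1)) * e' `^ (1 - 2 * q))).
  by ring.
rewrite cE -[leRHS]mulrA -[leRHS]mulrA; apply: ler_wpM2r => //.
by rewrite !mulr_ge0 ?powR_ge0.
Qed.

Theorem theorem1p3 (R : realType) (n : nat) (nu : probability (borel_rV R n) R)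
    (alpha : R) :
  2 / 3 < alpha -> alpha < 1 ->
  (cheeger nu alpha < +oo)%E ->
  (forall f : 'rV[R]_n -> R, lip1 f ->
     (sq_dev nu f <= (C2 alpha (fine (cheeger nu alpha)))%:E
                     * (energy nu f) `^ ((3 * alpha - 2) / alpha))%E)
  /\ (poincare2 nu ((3 * alpha - 2) / alpha)
        <= (C2 alpha (fine (cheeger nu alpha)))%:E)%E.
Proof.
move=> a23 a1 cfin; have a0 : 0 < alpha by lra.
pose q := alpha^-1 - 1.
have q0 : 0 < q by rewrite subr_gt0 invf_gt1.
have q2 : q < 2^-1.
  suff : alpha^-1 < (2 / 3)^-1 by rewrite /q invf_div; lra.
  by rewrite ltf_pV2 ?posrE// divr_gt0.
have aE : alpha = (q + 1)^-1 by rewrite /q subrK invrK.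
have expE : (3 * alpha - 2) / alpha = 1 - 2 * q by rewrite /q; field; rewrite gt_eqF.
have cE : cheeger nu alpha = (fine (cheeger nu alpha))%:E.
  by rewrite fineK// ge0_fin_numE// cheeger_ge0.
have I0 : 0 <= fine (cheeger nu alpha) by rewrite fine_ge0// cheeger_ge0.
have main (f : 'rV[R]_n -> R) : lip1 f ->
    (sq_dev nu f <= (C2 alpha (fine (cheeger nu alpha)))%:E
                     * (energy nu f) `^ ((3 * alpha - 2) / alpha))%E.
  move=> fl; rewrite expE; move: I0 cE; move: (fine _) => I I0 cE.
  have := @sq_dev_le R n nu q I f q0 q2 I0; rewrite -aE cE; exact.
split=> //; apply: ge_ereal_sup => _ [f fl <-]; have := main f fl.
have : (0 <= sq_dev nu f)%E.
  by rewrite /sq_dev unlock; apply: integral_ge0 => x _; rewrite lee_fin sqr_ge0.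
have : 0 <= C2 alpha (fine (cheeger nu alpha)) by rewrite /C2 !mulr_ge0 ?powR_ge0.
move: (C2 _ _) => C C0; move: (sq_dev _ _) => S S0.
have := poweR_ge0 (energy nu f) ((3 * alpha - 2) / alpha).
case: (_ `^ _)%E => [z| |]//=; last by rewrite invey mule0 lee_fin.
(* A zero denominator forces [S = 0] by the first claim, and 0/0 is read as 0. *)
rewrite lee_fin => z_ge0 SC; have [z0|] := eqVneq z 0.
  have -> : S = 0%E by apply/eqP; rewrite eq_le S0 andbT (le_trans SC)// z0 mule0.
  by rewrite mul0e lee_fin.
by rewrite neq_lt ltNge z_ge0/= => z0; rewrite inver (gt_eqF z0) lee_pdivrMr.
Qed.
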